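(* Let $\varphi:(0,1]^3\to\mathbb{R}$ and $\eta:(0,1]^2\to\mathbb{R}$ be the functions defined by explicit formulas (in terms of Rogers' dilogarithm $\mathcal{L}$) in the context. Then: (1) $\varphi$ is strictly increasing in each of its three variables on $(0,1]^3$, and $\eta$ is strictly increasing in each of its two variables on $(0,1]^2$. (2) For all $x,y\in(0,1]$, $$\varphi(x,y,y)\leq \eta(x,y).$$ (3) For all $x,y,z\in(0,1]$, setting $t:=\sqrt[3]{xyz}$, $$\varphi(x,y,z)\geq \varphi(t,t,t) > -24t^3\log(t)+24t^3.$$
   Context: $\mathcal{L}$ denotes Rogers' dilogarithm on $[0,1]$: $\mathcal{L}(s)=\sum_{n\ge1}\frac{s^n}{n^2}+\frac12\log(s)\log(1-s)$ for $0<s<1$, extended continuously by $\mathcal{L}(0)=0$, $\mathcal{L}(1)=\pi^2/6$. The function $\varphi$ (the measure in the Luo–Tan identity of an embedded pair of pants with boundary lengths $\ell_1,\ell_2,\ell_3$, written in the parameters $x_i=e^{-\ell_i/2}$) is $$\varphi(x_1,x_2,x_3)=4\sum_{(i,j,k)}\bigg[2\mathcal{L}\bigg(\frac{(x_ix_k+x_j)(1+x_1x_2x_3)}{x_j+x_i^2x_j+x_ix_k+x_ix_j^2x_k}\bigg)-2\mathcal{L}\bigg(\frac{x_j(1-x_k^2)}{x_j+x_i^2x_j+x_ix_k+x_ix_j^2x_k}\bigg)$$ $$-\mathcal{L}\bigg(\frac{(x_jx_k+x_i)(x_jx_i+x_k)}{(x_ix_k+x_j)(1+x_1x_2x_3)}\bigg)-\mathcal{L}\bigg(\frac{x_i^2x_j^2(1-x_k^2)^2}{(x_k+x_ix_j)(x_i+x_jx_k)(x_j+x_ix_k)(1+x_1x_2x_3)}\bigg)\bigg],$$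 where the sum is over all six ordered triples $(i,j,k)$ with $\{i,j,k\}=\{1,2,3\}$. The function $\eta$ (the corresponding measure of an improperly embedded pair of pants, obtained by cutting a one-holed torus with boundary geodesic $\beta$ along a simple closed geodesic $\alpha$, in the parameters $x=e^{-\ell(\beta)/2}$, $y=e^{-\ell(\alpha)/2}$) is $$\eta(x,y)=8\mathcal{L}\bigg(\frac{(x+1)^2y^2}{(x+y^2)(xy^2+1)}\bigg)-8\mathcal{L}\bigg(\frac{(1-x)^2y^2}{(x+y^2)(xy^2+1)}\bigg)-16\mathcal{L}\bigg(\frac{1-x}{1+y^2}\bigg)+16\mathcal{L}\bigg(\frac{xy^2+1}{1+y^2}\bigg)$$ $$-16\mathcal{L}\bigg(\frac{x+y^2}{xy^2+1}\bigg)-16\mathcal{L}\bigg(\frac{1-y^2}{1+x}\bigg)+16\mathcal{L}\bigg(\frac{xy^2+1}{1+x}\bigg).$$ For arguments in $(0,1]$ all the dilogarithm arguments lie in $[0,1]$. *)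

(* Defs.v *)
From Stdlib Require Import Reals.
From Coquelicot Require Import Coquelicot.
Open Scope R_scope.

(* Rogers' dilogarithm on [0,1].  The values outside [0,1] (0 to the left,
   PI^2/6 to the right) are junk: all arguments used in [phi] and [eta] lie in
   [0,1] when the variables lie in (0,1]. *)
Definition rogersL (s : R) : R :=
  if Rle_dec s 0 then 0
  else if Rle_dec 1 s then PI ^ 2 / 6
  else Series (fun n : nat => s ^ S n / INR (S n) ^ 2)
       + 1 / 2 * ln s * ln (1 - s).

(* Here a, b, c stand for x_i, x_j, x_k, so that a * b * c = x_1 x_2 x_3. *)
Definition phi_term (a b c : R) : R :=
  2 * rogersL ((a * c + b) * (1 + a * b * c)
               / (b + a ^ 2 * b + a * c + a * b ^ 2 * c))
  - 2 * rogersL (b * (1 - c ^ 2)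
                 / (b + a ^ 2 * b + a * c + a * b ^ 2 * c))
  - rogersL ((b * c + a) * (b * a + c)
             / ((a * c + b) * (1 + a * b * c)))
  - rogersL (a ^ 2 * b ^ 2 * (1 - c ^ 2) ^ 2
             / ((c + a * b) * (a + b * c) * (b + a * c) * (1 + a * b * c))).

Definition phi (x1 x2 x3 : R) : R :=
  4 * (phi_term x1 x2 x3 + phi_term x1 x3 x2
       + phi_term x2 x1 x3 + phi_term x2 x3 x1
       + phi_term x3 x1 x2 + phi_term x3 x2 x1).

Definition eta (x y : R) : R :=
  8 * rogersL ((x + 1) ^ 2 * y ^ 2 / ((x + y ^ 2) * (x * y ^ 2 + 1)))
  - 8 * rogersL ((1 - x) ^ 2 * y ^ 2 / ((x + y ^ 2) * (x * y ^ 2 + 1)))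
  - 16 * rogersL ((1 - x) / (1 + y ^ 2))
  + 16 * rogersL ((x * y ^ 2 + 1) / (1 + y ^ 2))
  - 16 * rogersL ((x + y ^ 2) / (x * y ^ 2 + 1))
  - 16 * rogersL ((1 - y ^ 2) / (1 + x))
  + 16 * rogersL ((x * y ^ 2 + 1) / (1 + x)).

Definition strictly_increasing_Ioc01 (f : R -> R) : Prop :=
  forall s t : R, 0 < s <= 1 -> 0 < t <= 1 -> s < t -> f s < f t.

(* [Rpower] agrees with the cube root on positive reals only. *)
Definition cbrt (s : R) : R := Rpower s (1 / 3).

(* Main.v *)
(* Since d L(U) = ((ln U) d(ln(1 - U)) - (ln(1 - U)) d(ln U)) / 2, dilogarithm identities
   can be checked by differentiation.  In this way, with u = xyz, r = y^2 and
     B(s, u) = L(s) + L(u/(1+u)) - L((s+u)/(1+u)),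
   one finds
     phi(x, y, z) = 16 (B(x^2, u) + B(y^2, u) + B(z^2, u)),
     eta(x, y) = 16 (L(x) + L(r) + L(xr/(1+xr)) - L((x+r)/(1+xr))),
     eta(x, y) - phi(x, y, y) = 8 (L(sin^2 (a+b)) - L(sin^2 a) - L(sin^2 b))
   with tan a = y sqrt x and tan b = y / sqrt x.  Monotonicity follows from
   1 - 1/c <= ln c <= c - 1 applied to the derivatives of the closed forms.  The comparison
   of phi and eta is the superadditivity of a -> L(sin^2 a): its derivative is symmetric
   about pi/4 and increases before.  For fixed u the function B is convex in ln s, so
   Jensen's inequality gives phi(x, y, z) >= phi(t, t, t).  The last bound holds in the limit
   t -> 0, and the difference of its two sides is increasing in t. *)
Require Import Defs.
From Stdlib Require Import Reals Lra Lia Psatz.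
From Coquelicot Require Import Coquelicot.
Open Scope R_scope.

(** L is not differentiable at 0 or 1: its slope blows up logarithmically there. Every argument by
    differentiation therefore stays in an open interval and uses only continuity at the ends. The
    closed forms are integrated in x from x = 0, where both sides collapse to known values. At 1 the
    identities are reached by a limit, since factors such as 1 - x vanish and have no logarithm.
    Continuity at 1 is also where the Basel sum enters: [rogersL] has the value PI^2/6 there by
    definition, and the series must be shown to tend to it. No five-term relation is used. By the
    alternating form of dL, a combination of values L(U) has derivative zero as soon as the same
    combination of the symbols U wedge (1 - U) vanishes in the exterior square of the multiplicative
    group generated by the factors of all U and 1 - U. Hence the logarithms and logarithmic
    derivatives of these factors are carried along as opaque unknowns, and each closed form ends in
    one call of [field]. *)

Lemma MVT_open (f df : R -> R) (a b : R) :
  a < b ->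
  (forall x, a < x < b -> is_derive f x (df x)) ->
  (forall x, a <= x <= b -> continuous f x) ->
  exists c, a < c < b /\ f b - f a = df c * (b - a).
Proof.
intros hab hd hc.
assert (pr1 : forall c, a < c < b -> derivable_pt f c).
{ intros c hc'. exists (df c). apply is_derive_Reals. now apply hd. }
assert (pr2 : forall c, a < c < b -> derivable_pt id c).
{ intros c _. apply derivable_pt_id. }
destruct (MVT f id a b pr1 pr2 hab) as [c [P e]].
- intros c hc'. apply continuity_pt_filterlim, hc, hc'.
- intros c _. apply derivable_continuous_pt, derivable_pt_id.
- exists c; split; [exact P|].
  rewrite (derive_pt_eq_0 f c (df c)) in e by (apply is_derive_Reals; auto).
  rewrite (derive_pt_eq_0 id c 1) in e by apply derivable_pt_lim_id.
  unfold id in e. lra.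
Qed.

Lemma increasing_of_derive_pos (f df : R -> R) (a b : R) :
  a < b ->
  (forall x, a < x < b -> is_derive f x (df x)) ->
  (forall x, a <= x <= b -> continuous f x) ->
  (forall x, a < x < b -> 0 < df x) -> f a < f b.
Proof.
intros hab hd hc hp.
destruct (MVT_open f df a b hab hd hc) as [c [h e]].
pose proof (Rmult_lt_0_compat _ (b - a) (hp c h)). lra.
Qed.

Lemma nondecreasing_of_derive_nonneg (f df : R -> R) (a b : R) :
  a <= b ->
  (forall x, a < x < b -> is_derive f x (df x)) ->
  (forall x, a <= x <= b -> continuous f x) ->
  (forall x, a < x < b -> 0 <= df x) -> f a <= f b.
Proof.
intros [hab | ->] hd hc hp; [|lra].
destruct (MVT_open f df a b hab hd hc) as [c [h e]].
pose proof (Rmult_le_pos _ (b - a) (hp c h)). lra.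
Qed.

Lemma eq_of_derive_zero (f : R -> R) (a b : R) :
  a <= b ->
  (forall x, a < x < b -> is_derive f x 0) ->
  (forall x, a <= x <= b -> continuous f x) -> f a = f b.
Proof.
intros [hab | ->] hd hc; [|easy].
destruct (MVT_open f (fun _ => 0) a b hab hd hc) as [c [h e]]. lra.
Qed.

(** * Elementary bounds for the logarithm *)

Lemma ln_le_sub1 (x : R) : 0 < x -> ln x <= x - 1.
Proof.
intros hx. pose proof (exp_ineq1_le (ln x)) as h.
rewrite exp_ln in h by easy. lra.
Qed.

Lemma ln_ge_1_sub_inv (x : R) : 0 < x -> 1 - / x <= ln x.
Proof.
intros hx. pose proof (ln_le_sub1 (/ x) (Rinv_0_lt_compat _ hx)) as h.
rewrite ln_Rinv in h by easy. lra.
Qed.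

(** * The Basel sum *)

Fixpoint psum (f : nat -> R) (n : nat) : R :=
  match n with O => 0 | S m => psum f m + f m end.

Lemma psum_ext (f g : nat -> R) n :
  (forall k, (k < n)%nat -> f k = g k) -> psum f n = psum g n.
Proof.
induction n as [|n IH]; intros h; simpl; [easy|].
rewrite IH, h by (auto with arith); easy.
Qed.

Lemma psum_le (f g : nat -> R) n :
  (forall k, (k < n)%nat -> f k <= g k) -> psum f n <= psum g n.
Proof.
induction n as [|n IH]; intros h; simpl; [lra|].
apply Rplus_le_compat; auto with arith.
Qed.

Lemma psum_scal (c : R) (f : nat -> R) n :
  psum (fun k => c * f k) n = c * psum f n.
Proof. induction n as [|n IH]; simpl; [ring|rewrite IH; ring]. Qed.

Lemma psum_plus (f g : nat -> R) n :
  psum (fun k => f k + g k) n = psum f n + psum g n.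
Proof. induction n as [|n IH]; simpl; [ring|rewrite IH; ring]. Qed.

Lemma psum_const (c : R) n : psum (fun _ => c) n = INR n * c.
Proof. induction n as [|n IH]; [simpl; ring|]. rewrite S_INR; simpl; rewrite IH; ring. Qed.

Lemma psum_head (f : nat -> R) n : psum f (S n) = f O + psum (fun k => f (S k)) n.
Proof. induction n as [|n IH]; simpl in *; [ring|rewrite IH; ring]. Qed.

Lemma psum_sum_n (f : nat -> R) n : sum_n f n = psum f (S n).
Proof.
induction n as [|n IH].
- rewrite sum_O. simpl. ring.
- rewrite sum_Sn, IH. reflexivity.
Qed.

(** Serves to bring together the two angles of one dyadic level that arise by halving a single angle
    of the level before: they sit at mirrored positions. *)
Lemma psum_fold (f : nat -> R) n :
  psum f (2 * n) = psum (fun k => f k + f (2 * n - 1 - k)%nat) n.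
Proof.
revert f; induction n as [|n IH]; intros f; [easy|].
replace (2 * S n)%nat with (S (S (2 * n))) by lia.
rewrite psum_head. change (psum (fun k => f (S k)) (S (2 * n))) with
  (psum (fun k => f (S k)) (2 * n) + f (S (2 * n))).
rewrite IH, psum_head.
rewrite (psum_ext (fun k => f (S k) + f (S (2 * n - 1 - k)))
                  (fun k => f (S k) + f (S (S (2 * n)) - 1 - S k)%nat)).
- replace (S (S (2 * n)) - 1 - 0)%nat with (S (2 * n)) by lia. ring.
- intros k hk. do 2 f_equal. lia.
Qed.

Lemma psum_parity (f : nat -> R) n :
  psum f (2 * n) =
  psum (fun k => f (2 * k)%nat) n + psum (fun k => f (2 * k + 1)%nat) n.
Proof.
induction n as [|n IH]; [simpl; ring|].
replace (2 * S n)%nat with (S (S (2 * n))) by lia. cbn [psum]. rewrite IH.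
replace (S (2 * n)) with (2 * n + 1)%nat by lia. ring.
Qed.

(** For k < 2^n these are the odd multiples of pi/2^(n+2) in (0, pi/2), so their inverse squares are
    the inverse odd squares up to the factor 16 * 4^n / pi^2. *)
Definition dyadic_angle (n k : nat) : R := (2 * INR k + 1) * PI / 2 ^ (n + 2).

Lemma dyadic_angle_bounds n k :
  (k < 2 ^ n)%nat -> 0 < dyadic_angle n k < PI / 2.
Proof.
intros hk. unfold dyadic_angle.
assert (hp : 0 < 2 ^ (n + 2)) by (apply pow_lt; lra).
assert (h : 2 * INR k + 1 < 2 * 2 ^ n).
{ apply (le_INR (S k)) in hk. rewrite S_INR, pow_INR in hk.
  change (INR 2) with 2 in hk. lra. }
pose proof PI_RGT_0. pose proof (pos_INR k).
split.
- apply Rdiv_lt_0_compat; [nra|easy].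
- apply Rmult_lt_reg_r with (2 ^ (n + 2)); [easy|].
  unfold Rdiv. rewrite Rmult_assoc, Rinv_l by lra.
  rewrite pow_add. nra.
Qed.

(* Halving the angle: 1/sin^2 t = (1/sin^2 (t/2) + 1/cos^2 (t/2)) / 4, and the
   angles pi/2 - t/2 are the upper half of the next dyadic level. *)
Lemma psum_inv_sin2_dyadic n :
  psum (fun k => / (sin (dyadic_angle n k)) ^ 2) (2 ^ n) = 2 * 4 ^ n.
Proof.
induction n as [|n IH].
- unfold dyadic_angle. cbn [psum Nat.pow INR].
  replace ((2 * 0 + 1) * PI / 2 ^ (0 + 2)) with (PI / 4) by (simpl; field).
  rewrite sin_PI4.
  assert (h : 0 < sqrt 2) by (apply sqrt_lt_R0; lra).
  pose proof (pow2_sqrt 2 ltac:(lra)) as e.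
  replace (1 / sqrt 2) with (sqrt 2 * / 2) by (rewrite <- e at 2; field; lra).
  rewrite Rpow_mult_distr, e. simpl; field.
- replace (2 ^ S n)%nat with (2 * 2 ^ n)%nat by (simpl; lia).
  rewrite psum_fold.
  rewrite (psum_ext _ (fun k => 4 * / (sin (dyadic_angle n k)) ^ 2)).
  + rewrite psum_scal, IH. simpl. ring.
  + intros k hk.
    pose proof (dyadic_angle_bounds n k hk) as hb.
    set (t := dyadic_angle n k) in *.
    assert (h1 : dyadic_angle (S n) k = t / 2).
    { unfold t, dyadic_angle. simpl. field. apply pow_nonzero; lra. }
    assert (h2 : dyadic_angle (S n) (2 * 2 ^ n - 1 - k) = PI / 2 - t / 2).
    { unfold t, dyadic_angle.
      replace (2 * INR (2 * 2 ^ n - 1 - k) + 1) with (4 * 2 ^ n - 2 * INR k - 1).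
      - rewrite !pow_add. simpl. field. apply pow_nonzero; lra.
      - replace (2 * 2 ^ n - 1 - k)%nat with (2 * 2 ^ n - (1 + k))%nat by lia.
        rewrite minus_INR by lia.
        rewrite mult_INR, plus_INR, pow_INR. change (INR 2) with 2. change (INR 1) with 1. ring. }
    rewrite h1, h2, sin_shift.
    assert (hs : 0 < sin (t / 2)) by (apply sin_gt_0; lra).
    assert (hc : 0 < cos (t / 2)) by (apply cos_gt_0; lra).
    pose proof (sin2_cos2 (t / 2)) as e. unfold Rsqr in e.
    replace (sin t) with (2 * sin (t / 2) * cos (t / 2))
      by (rewrite <- sin_2a; f_equal; lra).
    assert (e' : sin (t / 2) ^ 2 + cos (t / 2) ^ 2 = 1) by (rewrite <- e; ring).
    field_simplify_eq; [|lra]. lra.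
Qed.

Lemma lt_tan (t : R) : 0 < t < PI / 2 -> t * cos t < sin t.
Proof.
intros ht.
assert (h : sin 0 - 0 * cos 0 < sin t - t * cos t).
{ apply (increasing_of_derive_pos (fun t => sin t - t * cos t) (fun t => t * sin t)).
  - lra.
  - intros x hx. auto_derive; [easy|ring].
  - intros x hx. apply (ex_derive_continuous (fun t => sin t - t * cos t)).
    auto_derive. easy.
  - intros x hx. apply Rmult_lt_0_compat; [lra|]. apply sin_gt_0; lra. }
rewrite sin_0 in h. lra.
Qed.

(** The lower bound is cot^2 t, so the two inequalities are sin t < t < tan t. *)
Lemma inv_sq_sandwich (t : R) :
  0 < t < PI / 2 -> / sin t ^ 2 - 1 <= / t ^ 2 <= / sin t ^ 2.
Proof.
intros ht.
assert (hs : 0 < sin t) by (apply sin_gt_0; lra).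
assert (hc : 0 < cos t) by (apply cos_gt_0; lra).
pose proof (lt_tan t ht). pose proof (sin_lt_x t (proj1 ht)).
pose proof (sin2_cos2 t) as e. unfold Rsqr in e.
split.
- replace (/ sin t ^ 2 - 1) with (cos t ^ 2 / sin t ^ 2)
    by (field_simplify_eq; [lra|lra]).
  replace (cos t ^ 2 / sin t ^ 2) with (/ (sin t / cos t) ^ 2) by (field; lra).
  apply Rinv_le_contravar; [apply pow_lt; lra|].
  apply pow_incr. split; [lra|].
  apply Rmult_le_reg_r with (cos t); [easy|]. unfold Rdiv.
  rewrite Rmult_assoc, Rinv_l; lra.
- apply Rinv_le_contravar; [apply pow_lt; lra|]. apply pow_incr. lra.
Qed.

(** The sandwich loses at most 1 per term, hence 2^n out of the total 2 * 4^n of a level; after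
    scaling by [c] the error is pi^2/16 * 2^(-n). *)
Lemma psum_inv_odd_sq_bounds n :
  PI ^ 2 / 8 - PI ^ 2 / 16 * (/ 2) ^ n
  <= psum (fun k => / (2 * INR k + 1) ^ 2) (2 ^ n) <= PI ^ 2 / 8.
Proof.
pose proof PI_RGT_0 as hpi.
assert (h2n : 0 < 2 ^ n) by (apply pow_lt; lra).
assert (e4 : 4 ^ n = 2 ^ n * 2 ^ n) by (rewrite <- Rpow_mult_distr; f_equal; lra).
assert (ei : (/ 2) ^ n = / 2 ^ n) by (rewrite pow_inv; easy).
set (c := PI ^ 2 / (16 * 4 ^ n)).
assert (hc : 0 < c) by (unfold c; apply Rdiv_lt_0_compat; [apply pow_lt|]; nra).
rewrite (psum_ext _ (fun k => c * / (dyadic_angle n k) ^ 2)).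
2: { intros k _. unfold dyadic_angle, c. rewrite pow_add, e4.
     pose proof (pos_INR k). field. repeat split; lra. }
rewrite psum_scal.
replace (PI ^ 2 / 8 - PI ^ 2 / 16 * (/ 2) ^ n) with (c * (2 * 4 ^ n - 2 ^ n))
  by (unfold c; rewrite ei, e4; field; lra).
replace (PI ^ 2 / 8) with (c * (2 * 4 ^ n)) by (unfold c; rewrite e4; field; lra).
split; (apply Rmult_le_compat_l; [lra|]); rewrite <- psum_inv_sin2_dyadic.
- replace (2 ^ n) with (INR (2 ^ n) * 1) by (rewrite pow_INR; change (INR 2) with 2; ring).
  rewrite <- psum_const.
  replace (_ - _) with (psum (fun k => / sin (dyadic_angle n k) ^ 2) (2 ^ n)
     + -1 * psum (fun _ => 1) (2 ^ n)) by ring.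
  rewrite <- psum_scal, <- psum_plus.
  apply psum_le. intros k hk.
  pose proof (inv_sq_sandwich _ (dyadic_angle_bounds n k hk)). lra.
- apply psum_le. intros k hk. apply inv_sq_sandwich, dyadic_angle_bounds, hk.
Qed.

Lemma is_lim_seq_psum_inv_odd_sq :
  is_lim_seq (fun n => psum (fun k => / (2 * INR k + 1) ^ 2) (2 ^ n)) (PI ^ 2 / 8).
Proof.
apply is_lim_seq_le_le with
  (u := fun n => PI ^ 2 / 8 - PI ^ 2 / 16 * (/ 2) ^ n) (w := fun _ => PI ^ 2 / 8).
- intros n. apply psum_inv_odd_sq_bounds.
- replace (Finite (PI ^ 2 / 8)) with (Finite (PI ^ 2 / 8 - PI ^ 2 / 16 * 0))
    by (f_equal; ring).
  apply is_lim_seq_minus'; [apply is_lim_seq_const|].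
  apply (is_lim_seq_scal_l _ (PI ^ 2 / 16) 0).
  apply is_lim_seq_geom. rewrite Rabs_pos_eq; lra.
- apply is_lim_seq_const.
Qed.

Lemma ex_series_inv_sq : ex_series (fun n => / INR (S n) ^ 2).
Proof.
assert (hb : forall n, psum (fun n => / INR (S n) ^ 2) (S n) <= 2 - / INR (S n)).
{ intros n; induction n as [|n IH].
  - simpl. lra.
  - change (psum (fun n => / INR (S n) ^ 2) (S n) + / INR (S (S n)) ^ 2
            <= 2 - / INR (S (S n))).
    rewrite (S_INR (S n)).
    assert (h : 0 < INR (S n)) by (apply lt_0_INR; lia).
    set (m := INR (S n)) in *.
    assert (/ (m + 1) ^ 2 <= / m - / (m + 1)); [|lra].
    replace (/ m - / (m + 1)) with (/ (m * (m + 1))) by (field; lra).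
    apply Rinv_le_contravar; nra. }
destruct (ex_finite_lim_seq_incr (sum_n (fun n => / INR (S n) ^ 2)) 2) as [l hl].
- intros n. rewrite sum_Sn. unfold plus. cbn [AbelianMonoid.plus R_AbelianMonoid]. cbn -[INR pow sum_n].
  assert (0 < / INR (S (S n)) ^ 2); [|lra].
  apply Rinv_0_lt_compat, pow_lt, lt_0_INR. lia.
- intros n. rewrite psum_sum_n. pose proof (hb n).
  assert (0 < / INR (S n)); [|lra]. apply Rinv_0_lt_compat, lt_0_INR. lia.
- exists l. exact hl.
Qed.

Lemma filterlim_eventually_of_ge (f : nat -> nat) :
  (forall n, (n <= f n)%nat) -> filterlim f eventually eventually.
Proof.
intros h P [N hN]. exists N. intros n hn. apply hN. specialize (h n). lia.
Qed.

Theorem basel : is_series (fun n => / INR (S n) ^ 2) (PI ^ 2 / 6).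
Proof.
destruct ex_series_inv_sq as [Z hZ].
assert (hpow : forall n, (n < 2 ^ n)%nat) by (intros n; apply Nat.pow_gt_lin_r; lia).
assert (hsub : forall f : nat -> nat, (forall n, (n <= f n)%nat) ->
   is_lim_seq (fun n => psum (fun n => / INR (S n) ^ 2) (S (f n))) Z).
{ intros f hf.
  apply is_lim_seq_ext with (fun n => sum_n (fun n => / INR (S n) ^ 2) (f n)).
  - intros n. apply psum_sum_n.
  - apply (is_lim_seq_subseq (sum_n (fun n => / INR (S n) ^ 2)) Z f);
      [now apply filterlim_eventually_of_ge|exact hZ]. }
assert (h1 : is_lim_seq (fun n => psum (fun n => / INR (S n) ^ 2) (2 ^ n)) Z).
{ apply is_lim_seq_ext with
    (fun n => psum (fun n => / INR (S n) ^ 2) (S (2 ^ n - 1))).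
  - intros n. f_equal. specialize (hpow n). lia.
  - apply hsub. intros n. specialize (hpow n). lia. }
assert (h2 : is_lim_seq (fun n => psum (fun n => / INR (S n) ^ 2) (2 * 2 ^ n)) Z).
{ apply is_lim_seq_ext with
    (fun n => psum (fun n => / INR (S n) ^ 2) (S (2 * 2 ^ n - 1))).
  - intros n. f_equal. specialize (hpow n). lia.
  - apply hsub. intros n. specialize (hpow n). lia. }
(* Even indices carry the odd denominators, and odd indices a quarter of the sum itself, so in the
   limit Z = pi^2/8 + Z/4. *)
assert (h3 : is_lim_seq (fun n => psum (fun n => / INR (S n) ^ 2) (2 * 2 ^ n))
               (PI ^ 2 / 8 + / 4 * Z)).
{ apply is_lim_seq_ext with
    (fun n => psum (fun k => / (2 * INR k + 1) ^ 2) (2 ^ n)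
              + / 4 * psum (fun n => / INR (S n) ^ 2) (2 ^ n)).
  - intros n. rewrite psum_parity, <- psum_scal. f_equal.
    + apply psum_ext. intros k _. rewrite S_INR, mult_INR. easy.
    + apply psum_ext. intros k _. rewrite !S_INR, plus_INR, mult_INR. simpl INR.
      pose proof (pos_INR k). field. lra.
  - apply is_lim_seq_plus'; [apply is_lim_seq_psum_inv_odd_sq|].
    now apply (is_lim_seq_scal_l _ (/ 4) Z). }
apply is_lim_seq_unique in h2. apply is_lim_seq_unique in h3.
rewrite h2 in h3. injection h3 as h3.
replace (PI ^ 2 / 6) with Z by lra. exact hZ.
Qed.

(** * Rogers' dilogarithm *)

Lemma CV_radius_gt_of_bounded (a : nat -> R) (s : R) :
  (forall n, Rabs (a n) <= 1) -> Rabs s < 1 -> Rbar_lt (Rabs s) (CV_radius a).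
Proof.
intros ha hs. apply Rbar_lt_le_trans with 1; [exact hs|].
apply (proj1 (CV_radius_bounded a)). exists 1. intros n.
rewrite pow1, Rmult_1_r. apply ha.
Qed.

Lemma inv_INR_S_bounds n : 0 < / INR (S n) <= 1.
Proof.
assert (h : 1 <= INR (S n)) by (rewrite S_INR; pose proof (pos_INR n); lra).
split; [apply Rinv_0_lt_compat; lra|].
rewrite <- Rinv_1. apply Rinv_le_contravar; lra.
Qed.

Lemma inv_INR_S_sq_bounds n : 0 < / INR (S n) ^ 2 <= 1.
Proof. rewrite <- pow_inv. pose proof (inv_INR_S_bounds n). nra. Qed.

Lemma PSeries_log (s : R) :
  0 <= s < 1 -> s * PSeries (fun n => / INR (S n)) s = - ln (1 - s).
Proof.
intros hs. set (b := PS_incr_1 (fun n => / INR (S n))).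
assert (hr : forall x, Rabs x < 1 -> Rbar_lt (Rabs x) (CV_radius b)).
{ intros x hx. apply CV_radius_gt_of_bounded; [|exact hx].
  intros [|n]; unfold b; cbn -[INR].
  - unfold zero; simpl. rewrite Rabs_R0. lra.
  - pose proof (inv_INR_S_bounds n). rewrite Rabs_pos_eq; lra. }
assert (hd : forall x, 0 <= x < 1 ->
  is_derive (fun x => PSeries b x + ln (1 - x)) x 0).
{ intros x hx.
  replace 0 with (PSeries (PS_derive b) x + - / (1 - x)).
  - apply @is_derive_plus.
    + apply is_derive_PSeries, hr. rewrite Rabs_pos_eq; lra.
    + auto_derive; [lra|field; lra].
  - rewrite <- Series_geom by (rewrite Rabs_pos_eq; lra).
    unfold PSeries at 1. rewrite (Series_ext _ (fun n => x ^ n)); [ring|].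
    intros n. unfold PS_derive, b, PS_incr_1. field. apply not_0_INR. lia. }
rewrite <- (PSeries_incr_1 (fun n => / INR (S n))). fold b.
assert (h : PSeries b 0 + ln (1 - 0) = PSeries b s + ln (1 - s)).
{ apply (eq_of_derive_zero (fun x => PSeries b x + ln (1 - x))); [lra| |].
  - intros x hx. apply hd. lra.
  - intros x hx. apply (ex_derive_continuous (fun x => PSeries b x + ln (1 - x))).
    eexists. apply hd. lra. }
rewrite Rminus_0_r, ln_1, PSeries_0 in h.
unfold b at 1 in h. cbn in h. unfold zero in h; simpl in h. lra.
Qed.

Definition li2 (s : R) : R := Series (fun n => s ^ S n / INR (S n) ^ 2).

Lemma is_derive_li2 (s : R) : 0 < s < 1 -> is_derive li2 s (- ln (1 - s) / s).
Proof.
intros hs. set (b := PS_incr_1 (fun n => / INR (S n) ^ 2)).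
apply is_derive_ext with (PSeries b).
{ intros x. unfold b. rewrite PSeries_incr_1. unfold li2, PSeries.
  rewrite <- Series_scal_l. apply Series_ext. intros n. simpl. unfold Rdiv. ring. }
replace (- ln (1 - s) / s) with (PSeries (PS_derive b) s).
- apply is_derive_PSeries, CV_radius_gt_of_bounded.
  + intros [|n]; unfold b; cbn -[INR pow].
    * unfold zero; simpl. rewrite Rabs_R0. lra.
    * pose proof (inv_INR_S_sq_bounds n). rewrite Rabs_pos_eq; lra.
  + rewrite Rabs_pos_eq; lra.
- rewrite <- PSeries_log by lra.
  rewrite (PSeries_ext _ (fun n => / INR (S n))).
  + field. lra.
  + intros n. unfold PS_derive, b, PS_incr_1. field. apply not_0_INR. lia.
Qed.

Lemma li2_term_bounds (s : R) n :
  0 <= s <= 1 -> 0 <= s ^ S n / INR (S n) ^ 2 <= s * / INR (S n) ^ 2.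
Proof.
intros hs. pose proof (inv_INR_S_sq_bounds n). unfold Rdiv.
assert (0 <= s ^ n <= 1).
{ split; [apply pow_le; lra|]. rewrite <- (pow1 n). apply pow_incr. lra. }
change (s ^ S n) with (s * s ^ n).
assert (0 <= s * s ^ n <= s) by nra.
split; [apply Rmult_le_pos|apply Rmult_le_compat_r]; lra.
Qed.

Lemma ex_series_li2 (s : R) :
  0 <= s <= 1 -> ex_series (fun n => s ^ S n / INR (S n) ^ 2).
Proof.
intros hs. apply (ex_series_le (V := R_CompleteNormedModule) _ (fun n => s * / INR (S n) ^ 2)).
- intros n. pose proof (li2_term_bounds s n hs).
  change (Rabs (s ^ S n / INR (S n) ^ 2) <= s * / INR (S n) ^ 2).
  rewrite Rabs_pos_eq; lra.
- apply (ex_series_scal_l (K := R_AbsRing) s (fun n => / INR (S n) ^ 2)). apply ex_series_inv_sq.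
Qed.

(** Comes from s^(n+1) <= s. It serves at both ends: it forces [li2] to 0 at 0 and bounds it by
    pi^2/6 near 1. *)
Lemma li2_le (s : R) : 0 <= s <= 1 -> li2 s <= s * (PI ^ 2 / 6).
Proof.
intros hs. rewrite <- (is_series_unique _ _ basel), <- Series_scal_l.
apply Series_le; [intros n; now apply li2_term_bounds|].
apply (ex_series_scal_l (K := R_AbsRing) s (fun n => / INR (S n) ^ 2)). apply ex_series_inv_sq.
Qed.

Lemma psum_le_li2 (s : R) N :
  0 <= s <= 1 -> psum (fun n => s ^ S n / INR (S n) ^ 2) (S N) <= li2 s.
Proof.
intros hs. rewrite <- psum_sum_n.
apply (is_lim_seq_incr_compare (sum_n (fun n => s ^ S n / INR (S n) ^ 2))).
- apply Series_correct, ex_series_li2, hs.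
- intros n. rewrite sum_Sn. unfold plus. cbn -[INR pow sum_n].
  pose proof (li2_term_bounds s (S n) hs). lra.
Qed.

Lemma li2_nonneg (s : R) : 0 <= s <= 1 -> 0 <= li2 s.
Proof.
intros hs. apply Rle_trans with (2 := psum_le_li2 s 0 hs).
pose proof (li2_term_bounds s 0 hs). cbn -[INR pow]. lra.
Qed.

(** The lower half of Abel's limit theorem. The terms are nonnegative, so [li2] dominates each
    partial sum. A partial sum is a polynomial, and one that is within eps/2 of pi^2/6 at 1 stays
    within eps of it nearby. *)
Lemma li2_near_1 (eps : posreal) :
  locally 1 (fun s => s < 1 -> PI ^ 2 / 6 - eps < li2 s).
Proof.
pose proof basel as hb.
assert (he : 0 < eps / 2) by (pose proof (cond_pos eps); lra).
destruct (proj2 (is_lim_seq_spec (sum_n (fun n => / INR (S n) ^ 2)) (PI ^ 2 / 6)) hb (mkposreal _ he)) as [N hN].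
specialize (hN N (le_n N)). rewrite psum_sum_n in hN.
set (p := fun s => psum (fun n => s ^ S n / INR (S n) ^ 2) (S N)).
assert (hc : continuous p 1).
{ unfold p. generalize (S N) as M. induction M as [|M IH]; cbn -[INR pow].
  - apply continuous_const.
  - apply (continuous_plus (V := R_NormedModule)); [exact IH|].
    apply (ex_derive_continuous (fun s => s ^ S M / INR (S M) ^ 2)).
    auto_derive. easy. }
assert (hp1 : p 1 = psum (fun n => / INR (S n) ^ 2) (S N)).
{ apply psum_ext. intros k _. rewrite pow1. unfold Rdiv. ring. }
pose proof (proj1 (filterlim_locally p (p 1)) hc (mkposreal _ he)) as hl.
assert (hpos : locally 1 (fun s => 0 < s)) by (apply open_gt; lra).
generalize (filter_and _ _ hl hpos). apply filter_imp.
intros s [h1 h2] h3. pose proof (psum_le_li2 s N ltac:(lra)) as h4.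
fold (p s) in h4.
change (Rabs (p s - p 1) < eps / 2) in h1.
change (Rabs (psum (fun n => / INR (S n) ^ 2) (S N) - PI ^ 2 / 6) < eps / 2) in hN.
rewrite <- hp1 in hN.
apply Rabs_def2 in h1. apply Rabs_def2 in hN. lra.
Qed.

(** Makes the logarithmic part of L vanish at 0 and, by s -> 1 - s, at 1. The bound 1 - 1/c <= ln c
    at c = s would only give -s ln s <= 1 - s; taken at c = sqrt s it gives -s ln s <= 2 sqrt s. *)
Lemma ln_mul_ln_bounds (s : R) :
  0 < s <= 1 / 2 -> 0 <= ln s * ln (1 - s) <= 4 * sqrt s.
Proof.
intros hs.
assert (hq : 0 < sqrt s) by (apply sqrt_lt_R0; lra).
assert (hqq : sqrt s * sqrt s = s) by (apply sqrt_sqrt; lra).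
set (q := sqrt s) in *.
assert (h1 : ln s = 2 * ln q) by (rewrite <- hqq, ln_mult by easy; ring).
pose proof (ln_le_sub1 s ltac:(lra)) as h2.
pose proof (ln_ge_1_sub_inv q hq) as h3.
pose proof (ln_le_sub1 (1 - s) ltac:(lra)) as h4.
pose proof (ln_ge_1_sub_inv (1 - s) ltac:(lra)) as h5.
assert (h6 : 1 - / (1 - s) >= - 2 * s).
{ replace (1 - / (1 - s)) with (- s * / (1 - s)) by (field; lra).
  assert (/ (1 - s) <= / (1 / 2)) by (apply Rinv_le_contravar; lra).
  replace (/ (1 / 2)) with 2 in * by field. nra. }
assert (h7 : - ln s * s <= 2 * q).
{ rewrite h1. assert (- ln q * q <= 1).
  - apply Rle_trans with (/ q * q); [|rewrite Rinv_l; lra].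
    apply Rmult_le_compat_r; lra.
  - rewrite <- hqq. nra. }
split; [nra|].
assert (ln s * ln (1 - s) <= - ln s * (2 * s)); [|lra].
replace (ln s * ln (1 - s)) with (- ln s * - ln (1 - s)) by ring.
apply Rmult_le_compat_l; lra.
Qed.

Lemma rogersL_inside (s : R) :
  0 < s < 1 -> rogersL s = li2 s + 1 / 2 * ln s * ln (1 - s).
Proof.
intros hs. unfold rogersL, li2.
destruct (Rle_dec s 0); [lra|]. destruct (Rle_dec 1 s); [lra|easy].
Qed.

Lemma rogersL_le0 (s : R) : s <= 0 -> rogersL s = 0.
Proof. intros hs. unfold rogersL. destruct (Rle_dec s 0); [easy|lra]. Qed.

Lemma rogersL_ge1 (s : R) : 1 <= s -> rogersL s = PI ^ 2 / 6.
Proof.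
intros hs. unfold rogersL.
destruct (Rle_dec s 0); [lra|]. destruct (Rle_dec 1 s); [easy|lra].
Qed.

Lemma rogersL_0 : rogersL 0 = 0.
Proof. apply rogersL_le0; lra. Qed.

Lemma rogersL_1 : rogersL 1 = PI ^ 2 / 6.
Proof. apply rogersL_ge1; lra. Qed.

Lemma is_derive_rogersL (s : R) :
  0 < s < 1 ->
  is_derive rogersL s (- 1 / 2 * (ln (1 - s) / s + ln s / (1 - s))).
Proof.
intros hs.
apply is_derive_ext_loc with (fun s => li2 s + 1 / 2 * ln s * ln (1 - s)).
- apply filter_imp with (fun x => 0 < x /\ x < 1).
  + intros x hx. now rewrite rogersL_inside.
  + apply filter_and; [apply open_gt|apply open_lt]; lra.
- replace (- 1 / 2 * (ln (1 - s) / s + ln s / (1 - s))) with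
    (- ln (1 - s) / s + (1 / 2 * ln (1 - s) / s - 1 / 2 * ln s / (1 - s)))
    by (field; lra).
  apply @is_derive_plus; [now apply is_derive_li2|].
  auto_derive; [lra|unfold Rminus; field; lra].
Qed.

Lemma sqrt_near_0 (eps : posreal) : locally 0 (fun s => 0 < s -> sqrt s < eps).
Proof.
pose proof (cond_pos eps) as he.
assert (h : 0 < eps * eps) by nra.
exists (mkposreal _ h). intros s hs hp. change (Rabs (s - 0) < eps * eps) in hs.
rewrite Rminus_0_r, Rabs_pos_eq in hs by lra.
rewrite <- (sqrt_square eps) by lra. apply sqrt_lt_1; lra.
Qed.

Lemma continuous_rogersL_0 : continuous rogersL 0.
Proof.
apply (proj2 (filterlim_locally rogersL (rogersL 0))). intros eps. rewrite rogersL_0.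
(* 5 = 3 + 2: [li2 s] is at most 3 sqrt s, and half of the product of logarithms is at most 2 sqrt
   s. *)
assert (he : 0 < eps / 5) by (pose proof (cond_pos eps); lra).
assert (h1 : locally 0 (fun s => s < 1 / 2)) by (apply open_lt; lra).
generalize (filter_and _ _ h1 (sqrt_near_0 (mkposreal _ he))). apply filter_imp.
intros s [h2 h3]. simpl in h3. change (Rabs (rogersL s - 0) < eps).
rewrite Rminus_0_r.
destruct (Rle_lt_dec s 0) as [h|h].
- rewrite rogersL_le0, Rabs_R0 by easy. apply cond_pos.
- specialize (h3 h). rewrite rogersL_inside by lra.
  pose proof (ln_mul_ln_bounds s ltac:(lra)).
  pose proof (li2_nonneg s ltac:(lra)). pose proof (li2_le s ltac:(lra)).
  assert (hq : 0 < sqrt s) by (apply sqrt_lt_R0; lra).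
  assert (hqq : sqrt s * sqrt s = s) by (apply sqrt_sqrt; lra).
  pose proof PI_4. pose proof PI_RGT_0.
  assert (s <= sqrt s) by nra.
  assert (PI ^ 2 / 6 <= 3) by nra.
  assert (li2 s <= 3 * sqrt s) by nra.
  rewrite Rabs_pos_eq by lra. lra.
Qed.

Lemma Rminus_1_minus (x : R) : 1 - (1 - x) = x.
Proof. ring. Qed.

Lemma continuous_rogersL_1 : continuous rogersL 1.
Proof.
apply (proj2 (filterlim_locally rogersL (rogersL 1))). intros eps. rewrite rogersL_1.
assert (he : 0 < eps / 5) by (pose proof (cond_pos eps); lra).
assert (h1 : locally 1 (fun s => 1 / 2 < s)) by (apply open_gt; lra).
assert (h0 : locally 1 (fun s => 0 < 1 - s -> sqrt (1 - s) < eps / 5)).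
{ destruct (sqrt_near_0 (mkposreal _ he)) as [d hd]. exists d. intros s hs hp.
  apply (hd (1 - s)); [|easy]. change (Rabs (s - 1) < d) in hs.
  change (Rabs (1 - s - 0) < d). rewrite <- Rabs_Ropp.
  replace (- (1 - s - 0)) with (s - 1) by ring. easy. }
generalize (filter_and _ _ (filter_and _ _ h1 h0) (li2_near_1 (mkposreal _ he))).
apply filter_imp.
intros s [[h2 h3] h4]. simpl in h4. change (Rabs (rogersL s - PI ^ 2 / 6) < eps).
destruct (Rle_lt_dec 1 s) as [h|h].
- rewrite rogersL_ge1, Rminus_eq_0, Rabs_R0 by easy. apply cond_pos.
- specialize (h3 ltac:(lra)). specialize (h4 h). rewrite rogersL_inside by lra.
  pose proof (ln_mul_ln_bounds (1 - s) ltac:(lra)) as h5.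
  rewrite Rminus_1_minus in h5.
  pose proof (li2_le s ltac:(lra)).
  pose proof PI_RGT_0.
  assert (s * (PI ^ 2 / 6) <= PI ^ 2 / 6) by nra.
  apply Rabs_def1; lra.
Qed.

Lemma continuous_rogersL (s : R) : continuous rogersL s.
Proof.
destruct (Rtotal_order s 0) as [h|[->|h]]; [|apply continuous_rogersL_0|].
- apply continuous_ext_loc with (fun _ => 0); [|apply continuous_const].
  apply filter_imp with (fun x => x < 0); [|now apply open_lt].
  intros x hx. now rewrite rogersL_le0 by lra.
- destruct (Rtotal_order s 1) as [h'|[->|h']]; [|apply continuous_rogersL_1|].
  + apply (ex_derive_continuous rogersL). eexists. now apply is_derive_rogersL.
  + apply continuous_ext_loc with (fun _ => PI ^ 2 / 6); [|apply continuous_const].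
    apply filter_imp with (fun x => 1 < x); [|now apply open_gt].
    intros x hx. now rewrite rogersL_ge1 by lra.
Qed.

Lemma continuous_rogersL_comp (f : R -> R) (x : R) :
  ex_derive f x -> continuous (fun x => rogersL (f x)) x.
Proof.
intros h. apply (continuous_comp f rogersL).
- now apply (ex_derive_continuous f).
- apply continuous_rogersL.
Qed.

Lemma rogersL_lt (s t : R) : 0 <= s -> s < t -> t <= 1 -> rogersL s < rogersL t.
Proof.
intros hs hst ht.
apply (increasing_of_derive_pos rogersL
  (fun s => - 1 / 2 * (ln (1 - s) / s + ln s / (1 - s)))); [easy| | |].
- intros x hx. apply is_derive_rogersL. lra.
- intros x _. apply continuous_rogersL.
- intros x hx.
  assert (ln (1 - x) / x < 0).
  { apply Rdiv_neg_pos; [|lra]. rewrite <- ln_1. apply ln_increasing; lra. }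
  assert (ln x / (1 - x) < 0).
  { apply Rdiv_neg_pos; [|lra]. rewrite <- ln_1. apply ln_increasing; lra. }
  lra.
Qed.

Lemma rogersL_le (s t : R) : 0 <= s -> s <= t -> t <= 1 -> rogersL s <= rogersL t.
Proof.
intros hs [hst | ->] ht; [|lra]. apply Rlt_le. now apply rogersL_lt.
Qed.

(* Junk values make the reflection formula hold on the whole line. *)
Lemma rogersL_reflect (s : R) : rogersL s + rogersL (1 - s) = PI ^ 2 / 6.
Proof.
destruct (Rle_lt_dec s 0) as [h|h].
{ rewrite rogersL_le0, rogersL_ge1 by lra. ring. }
destruct (Rle_lt_dec 1 s) as [h'|h'].
{ rewrite rogersL_ge1, rogersL_le0 by lra. ring. }
assert (e : rogersL 0 + rogersL (1 - 0) = rogersL s + rogersL (1 - s)).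
{ apply (eq_of_derive_zero (fun s => rogersL s + rogersL (1 - s))); [lra| |].
  - intros x hx.
    pose proof (is_derive_rogersL x ltac:(lra)) as h1.
    pose proof (is_derive_rogersL (1 - x) ltac:(lra)) as h2.
    assert (h3 : is_derive (fun x => 1 - x) x (-1)) by (auto_derive; [easy|ring]).
    pose proof (is_derive_comp rogersL (fun x => 1 - x) x _ _ h2 h3) as h4.
    pose proof (is_derive_plus _ _ _ _ _ h1 h4) as h5.
    match type of h5 with is_derive _ _ ?d => replace 0 with d end; [exact h5|].
    unfold plus, scal; simpl. unfold mult; simpl.
    replace (1 - (1 - x)) with x by ring. field. lra.
  - intros x _. apply (continuous_plus (V := R_NormedModule)).
    + apply continuous_rogersL.
    + apply (continuous_rogersL_comp (fun x => 1 - x)). auto_derive. easy. }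
rewrite <- e, Rminus_0_r, rogersL_0, rogersL_1. ring.
Qed.

(** * Differentiating sums of dilogarithms *)

(** [d] is the logarithmic derivative f'/f at [t], so that a product of functions adds both the [l]
    and the [d]. *)
Definition log_jet (f : R -> R) (t l d : R) : Prop :=
  0 < f t /\ ln (f t) = l /\ is_derive f t (f t * d).

Lemma log_jet_ext (f g : R -> R) (t l d : R) :
  (forall x, f x = g x) -> log_jet f t l d -> log_jet g t l d.
Proof.
intros e [h1 [h2 h3]]. rewrite (e t) in h1, h2, h3. split; [|split]; [easy|easy|].
exact (is_derive_ext f g t _ e h3).
Qed.

Lemma log_jet_mult (f g : R -> R) (t l d m e : R) :
  log_jet f t l d -> log_jet g t m e ->
  log_jet (fun x => f x * g x) t (l + m) (d + e).
Proof.
intros [hf [lf df]] [hg [lg dg]]. split; [|split].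
- now apply Rmult_lt_0_compat.
- now rewrite ln_mult, lf, lg by easy.
- replace (f t * g t * (d + e)) with (f t * d * g t + f t * (g t * e)) by ring.
  apply (is_derive_mult f g t _ _ df dg). intros; apply Rmult_comm.
Qed.

Lemma log_jet_sqr (f : R -> R) (t l d : R) :
  log_jet f t l d -> log_jet (fun x => f x ^ 2) t (l + l) (d + d).
Proof.
intros h. apply log_jet_ext with (fun x => f x * f x); [intros; ring|].
now apply log_jet_mult.
Qed.

Lemma log_jet_const (c t : R) : 0 < c -> log_jet (fun _ => c) t (ln c) 0.
Proof.
intros hc. split; [|split]; [easy|easy|]. rewrite Rmult_0_r. apply @is_derive_const.
Qed.

Lemma log_jet_one (t : R) : log_jet (fun _ => 1) t 0 0.
Proof. rewrite <- ln_1 at 1. apply log_jet_const; lra. Qed.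

(** The existential hides the values on purpose: the dilogarithm identities hold with [l] and [d] of
    every factor as free unknowns. *)
Lemma log_jet_intro (f : R -> R) (t : R) :
  0 < f t -> ex_derive f t -> exists l d, log_jet f t l d.
Proof.
intros hf hd. exists (ln (f t)), (Derive f t / f t). split; [|split]; [easy|easy|].
replace (f t * (Derive f t / f t)) with (Derive f t) by (field; lra).
now apply Derive_correct.
Qed.

(* The derivative is half of (ln U) d(ln V) - (ln V) d(ln U) with U = N/D and V = M/D.
   This form is alternating in the logarithms of the factors of N, M and D, which
   turns dilogarithm identities into linear algebra over those factors. *)
Lemma is_derive_rogersL_quot (N M D : R -> R) (t lN n lM m lD d : R) :
  (forall x, N x + M x = D x) ->
  log_jet N t lN n -> log_jet M t lM m -> log_jet D t lD d ->
  is_derive (fun x => rogersL (N x / D x)) t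
    (1 / 2 * ((lN - lD) * (m - d) - (lM - lD) * (n - d))).
Proof.
intros e [hN [eN dN]] [hM [eM dM]] [hD [eD dD]].
assert (e' : N t * n + M t * m = D t * d).
{ rewrite <- (is_derive_unique _ _ _ dD). symmetry. apply is_derive_unique.
  apply is_derive_ext with (fun x => N x + M x); [exact e|].
  now apply @is_derive_plus. }
specialize (e t).
assert (hU : 0 < N t / D t) by now apply Rdiv_lt_0_compat.
assert (eV : 1 - N t / D t = M t / D t) by (field_simplify_eq; lra).
assert (hV : 0 < M t / D t) by now apply Rdiv_lt_0_compat.
assert (dU : is_derive (fun x => N x / D x) t (N t / D t * (n - d))).
{ replace (N t / D t * (n - d)) with ((N t * n * D t - N t * (D t * d)) / D t ^ 2)
    by (field; lra).
  apply is_derive_div; [easy|easy|lra]. }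
pose proof (is_derive_comp rogersL (fun x => N x / D x) t _ _
  (is_derive_rogersL (N t / D t) ltac:(lra)) dU) as h.
match type of h with is_derive _ _ ?l => replace (1 / 2 * _) with l end; [exact h|].
unfold scal; simpl; unfold mult; simpl. rewrite eV.
rewrite !ln_div, eN, eM, eD by easy.
replace m with ((D t * d - N t * n) / M t) by (field_simplify_eq; lra).
rewrite <- e. field. lra.
Qed.

Ltac nonneg := repeat first
  [ lra | assumption | apply Rplus_le_le_0_compat | apply Rmult_le_pos | apply pow_le ].

Ltac pos := repeat first
  [ lra | assumption | apply Rmult_lt_0_compat | apply pow_lt
  | (apply Rplus_lt_le_0_compat; [solve [pos] | solve [nonneg]])
  | (apply Rplus_le_lt_0_compat; [solve [nonneg] | solve [pos]]) ].

Ltac find_jet := first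
  [ eassumption
  | match goal with H : log_jet _ _ _ _ |- _ =>
      apply log_jet_ext with (2 := H); intros; cbv beta; ring end ].

Ltac log_jets := repeat first
  [ find_jet | apply log_jet_sqr | apply log_jet_mult | apply log_jet_one ].

Ltac dilog_quot N M D t :=
  eapply (is_derive_rogersL_quot N M D t);
    [intros; cbv beta; ring | log_jets | log_jets | log_jets].

(** The derivative of L(U) when V = 1 - U: an alternating bilinear form in the jets, which
    represents the symbol U wedge V. *)
Definition wedge (lU dU lV dV : R) : R := 1 / 2 * (lU * dV - lV * dU).

(** Rests on a factorization: for each of the four arguments U, the numerator of 1 - U splits into
    the same kinds of factors as U. These numerators are the second arguments of [dilog_quot] below.
    The jet E belongs to the polynomial of D with a and b exchanged, and both occur in the
    complement of the last argument. *)
Lemma is_derive_phi_term (a b c : R -> R)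
  (t la da lb db lc dc lCa dCa lCc dCc lAa dAa lAb dAb lAc dAc lP dP lD dD lE dE : R) :
  log_jet a t la da -> log_jet b t lb db -> log_jet c t lc dc ->
  log_jet (fun x => 1 - a x ^ 2) t lCa dCa ->
  log_jet (fun x => 1 - c x ^ 2) t lCc dCc ->
  log_jet (fun x => a x + b x * c x) t lAa dAa ->
  log_jet (fun x => b x + a x * c x) t lAb dAb ->
  log_jet (fun x => c x + a x * b x) t lAc dAc ->
  log_jet (fun x => 1 + a x * b x * c x) t lP dP ->
  log_jet (fun x => b x + a x ^ 2 * b x + a x * c x + a x * b x ^ 2 * c x) t lD dD ->
  log_jet (fun x => a x + b x ^ 2 * a x + b x * c x + b x * a x ^ 2 * c x) t lE dE ->
  is_derive (fun x => phi_term (a x) (b x) (c x)) t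
   (2 * wedge (lAb + lP - lD) (dAb + dP - dD)
          (2 * la + lb + lCc - lD) (2 * da + db + dCc - dD)
    - 2 * wedge (lb + lCc - lD) (db + dCc - dD) (lAa + lAc - lD) (dAa + dAc - dD)
    - wedge (lAa + lAc - lAb - lP) (dAa + dAc - dAb - dP)
        (lb + lCa + lCc - lAb - lP) (db + dCa + dCc - dAb - dP)
    - wedge (2 * la + 2 * lb + 2 * lCc - lAa - lAb - lAc - lP)
        (2 * da + 2 * db + 2 * dCc - dAa - dAb - dAc - dP)
        (lc + lD + lE - lAa - lAb - lAc - lP) (dc + dD + dE - dAa - dAb - dAc - dP)).
Proof.
intros ha hb hc hCa hCc hAa hAb hAc hP hD hE.
apply is_derive_ext with (fun x =>
  2 * rogersL ((b x + a x * c x) * (1 + a x * b x * c x) /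
      (b x + a x ^ 2 * b x + a x * c x + a x * b x ^ 2 * c x))
  - 2 * rogersL (b x * (1 - c x ^ 2) /
      (b x + a x ^ 2 * b x + a x * c x + a x * b x ^ 2 * c x))
  - rogersL ((a x + b x * c x) * (c x + a x * b x) /
      ((b x + a x * c x) * (1 + a x * b x * c x)))
  - rogersL (a x ^ 2 * b x ^ 2 * (1 - c x ^ 2) ^ 2 /
      ((c x + a x * b x) * (a x + b x * c x) * (b x + a x * c x)
            * (1 + a x * b x * c x)))).
{ intros x. unfold phi_term. repeat first [ring | f_equal]. }
(* The derivative is left open, assembled from the jets of the factors, and compared with the stated
   one only at the end. *)
eapply eq_rect with (P := is_derive _ t).
- apply (is_derive_minus (V := R_NormedModule));
    [apply (is_derive_minus (V := R_NormedModule));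
      [apply (is_derive_minus (V := R_NormedModule)); apply is_derive_scal|]|].
  + dilog_quot (fun x => (b x + a x * c x) * (1 + a x * b x * c x))
      (fun x => a x ^ 2 * b x * (1 - c x ^ 2))
      (fun x => b x + a x ^ 2 * b x + a x * c x + a x * b x ^ 2 * c x) t.
  + dilog_quot (fun x => b x * (1 - c x ^ 2))
      (fun x => (a x + b x * c x) * (c x + a x * b x))
      (fun x => b x + a x ^ 2 * b x + a x * c x + a x * b x ^ 2 * c x) t.
  + dilog_quot (fun x => (a x + b x * c x) * (c x + a x * b x))
      (fun x => b x * (1 - a x ^ 2) * (1 - c x ^ 2))
      (fun x => (b x + a x * c x) * (1 + a x * b x * c x)) t.
  + dilog_quot (fun x => a x ^ 2 * b x ^ 2 * (1 - c x ^ 2) ^ 2)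
      (fun x => c x * (b x + a x ^ 2 * b x + a x * c x + a x * b x ^ 2 * c x)
            * (a x + b x ^ 2 * a x + b x * c x + b x * a x ^ 2 * c x))
      (fun x => (c x + a x * b x) * (a x + b x * c x) * (b x + a x * c x)
            * (1 + a x * b x * c x)) t.
- unfold wedge, minus, plus, opp, scal; simpl. unfold mult; simpl. field.
Qed.

(** * Closed forms of phi and eta *)

Definition summand (s u : R) : R :=
  rogersL s + rogersL (u / (1 + u)) - rogersL ((s + u) / (1 + u)).

Lemma continuous_Rplus (f g : R -> R) (x : R) :
  continuous f x -> continuous g x -> continuous (fun x => f x + g x) x.
Proof. apply (continuous_plus (V := R_NormedModule)). Qed.

Lemma continuous_Rminus (f g : R -> R) (x : R) :
  continuous f x -> continuous g x -> continuous (fun x => f x - g x) x.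
Proof. apply (continuous_minus (V := R_NormedModule)). Qed.

Lemma continuous_Rscal (k : R) (f : R -> R) (x : R) :
  continuous f x -> continuous (fun x => k * f x) x.
Proof. apply (continuous_scal_r k f x). Qed.

Ltac cont := repeat lazymatch goal with
  | |- continuous (fun x => rogersL (@?f x)) _ => apply (continuous_rogersL_comp f)
  | |- continuous (fun x => @?f x - @?g x) _ => apply (continuous_Rminus f g)
  | |- continuous (fun x => @?f x + @?g x) _ => apply (continuous_Rplus f g)
  | |- continuous (fun x => ?k * @?f x) _ => apply (continuous_Rscal k f) end.

(* [auto_derive] needs the bound variable to have type [R] syntactically. *)
Ltac ex_der :=
  match goal with |- ex_derive ?f ?x =>
    let g := eval cbv beta in (fun y : R => f y) in change (ex_derive g x) end;
  auto_derive; repeat split; try easy; apply Rgt_not_eq; pos.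

Lemma continuous_phi_1 (x y z : R) :
  0 <= x -> 0 < y -> 0 < z -> continuous (fun x => phi x y z) x.
Proof.
intros hx hy hz. unfold phi, phi_term. cont; ex_der.
Qed.

Lemma continuous_summand (f g : R -> R) (x : R) :
  ex_derive f x -> ex_derive g x -> 0 <= g x ->
  continuous (fun x => summand (f x) (g x)) x.
Proof.
intros hf hg h. unfold summand. cont; auto_derive; repeat split; try easy; lra.
Qed.

Lemma phi_swap12 (x y z : R) : phi x y z = phi y x z.
Proof. unfold phi. ring. Qed.

Lemma phi_swap13 (x y z : R) : phi x y z = phi z y x.
Proof. unfold phi. ring. Qed.


Lemma phi_term_0_l (b c : R) : 0 < b -> phi_term 0 b c = rogersL (c ^ 2).
Proof.
intros hb. unfold phi_term.
replace (_ / _) with 1 at 1 by (field; lra).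
replace (b * (1 - c ^ 2) / _) with (1 - c ^ 2) by (field; lra).
replace ((b * c + 0) * (b * 0 + c) / _) with (c ^ 2) by (field; lra).
replace (0 ^ 2 * b ^ 2 * (1 - c ^ 2) ^ 2 / _) with 0 by (unfold Rdiv; ring).
pose proof (rogersL_reflect (c ^ 2)). rewrite rogersL_0, rogersL_1. lra.
Qed.

Lemma phi_term_0_m (a c : R) : 0 < a -> 0 < c -> phi_term a 0 c = PI ^ 2 / 6.
Proof.
intros ha hc. unfold phi_term.
replace (_ / _) with 1 at 1 by (field; lra).
replace (0 * (1 - c ^ 2) / _) with 0 by (unfold Rdiv; ring).
replace ((0 * c + a) * (0 * a + c) / _) with 1 by (field; lra).
replace (a ^ 2 * 0 ^ 2 * (1 - c ^ 2) ^ 2 / _) with 0 by (unfold Rdiv; ring).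
rewrite rogersL_0, rogersL_1. lra.
Qed.

Lemma phi_term_0_r (a b : R) :
  0 < a -> 0 < b -> phi_term a b 0 = - rogersL (a ^ 2) - PI ^ 2 / 6.
Proof.
intros ha hb. unfold phi_term.
assert (0 < 1 + a ^ 2) by pos.
replace (_ / _) with (1 / (1 + a ^ 2)) at 1 by (field; repeat split; nra).
replace (b * (1 - 0 ^ 2) / _) with (1 / (1 + a ^ 2)) by (field; repeat split; nra).
replace ((b * 0 + a) * (b * a + 0) / _) with (a ^ 2) by (field; lra).
replace (a ^ 2 * b ^ 2 * (1 - 0 ^ 2) ^ 2 / _) with 1 by (field; lra).
rewrite rogersL_1. lra.
Qed.

(** The constant of integration for the closed form. Among the six terms, L(y^2), L(z^2) and both
    copies of pi^2/6 each appear once with either sign. *)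
Lemma phi_0 (y z : R) : 0 < y -> 0 < z -> phi 0 y z = 0.
Proof.
intros hy hz. unfold phi.
rewrite !phi_term_0_l, !phi_term_0_m, !phi_term_0_r by easy. ring.
Qed.

Lemma summand_0_r (s : R) : summand s 0 = 0.
Proof.
unfold summand. replace (0 / (1 + 0)) with 0 by field.
replace ((s + 0) / (1 + 0)) with s by field. rewrite rogersL_0. ring.
Qed.

Lemma is_derive_rogersL_jet (s : R -> R) (t ls ds lc dc : R) :
  log_jet s t ls ds -> log_jet (fun x => 1 - s x) t lc dc ->
  is_derive (fun x => rogersL (s x)) t (wedge ls ds lc dc).
Proof.
intros hs hc. apply is_derive_ext with (fun x => rogersL (s x / 1)).
{ intros x. now rewrite Rdiv_1_r. }
replace (wedge ls ds lc dc) with (1 / 2 * ((ls - 0) * (dc - 0) - (lc - 0) * (ds - 0)))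
  by (unfold wedge; field).
dilog_quot s (fun x => 1 - s x) (fun _ : R => 1) t.
Qed.

Lemma is_derive_summand (s u : R -> R) (t ls ds lc dc lu du lp dp lm dm : R) :
  log_jet s t ls ds -> log_jet (fun x => 1 - s x) t lc dc ->
  log_jet u t lu du -> log_jet (fun x => 1 + u x) t lp dp ->
  log_jet (fun x => s x + u x) t lm dm ->
  is_derive (fun x => summand (s x) (u x)) t
    (wedge ls ds lc dc + wedge (lu - lp) (du - dp) (- lp) (- dp)
     - wedge (lm - lp) (dm - dp) (lc - lp) (dc - dp)).
Proof.
intros hs hc hu hp hm. unfold summand.
eapply eq_rect with (P := is_derive _ t).
- apply (is_derive_minus (V := R_NormedModule));
    [apply (is_derive_plus (V := R_NormedModule))|].
  + eapply (is_derive_rogersL_jet s); eassumption.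
  + dilog_quot u (fun _ : R => 1) (fun x => 1 + u x) t.
  + dilog_quot (fun x => s x + u x) (fun x => 1 - s x) (fun x => 1 + u x) t.
- unfold wedge, minus, plus, opp; simpl. field.
Qed.

Ltac derive_sums := repeat lazymatch goal with
  | |- is_derive (fun x => @?f x + @?g x) _ _ =>
    apply (is_derive_plus (V := R_NormedModule))
  | |- is_derive (fun x => @?f x - @?g x) _ _ =>
    apply (is_derive_minus (V := R_NormedModule))
  | |- is_derive (fun x => ?k * @?f x) _ _ => apply is_derive_scal end.

Ltac get_jet f t l d h :=
  let l' := fresh l in let d' := fresh d in let h' := fresh h in
  destruct (log_jet_intro f t) as [l' [d' h']];
    [cbv beta; pos | ex_der | ].

Lemma phi_closed_form_open (x y z : R) :
  0 < x < 1 -> 0 < y < 1 -> 0 < z < 1 ->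
  phi x y z = 16 * (summand (x ^ 2) (x * y * z) + summand (y ^ 2) (x * y * z)
                    + summand (z ^ 2) (x * y * z)).
Proof.
intros hx hy hz.
set (g := fun x => phi x y z - 16 * (summand (x ^ 2) (x * y * z)
   + summand (y ^ 2) (x * y * z) + summand (z ^ 2) (x * y * z))).
assert (hg : g 0 = g x); [|unfold g in hg].
2: { rewrite phi_0 in hg by lra.
     replace (0 * y * z) with 0 in hg by ring. rewrite !summand_0_r in hg. lra. }
apply eq_of_derive_zero; [lra| |].
- intros t ht. assert (ht' : 0 < t < 1) by lra. unfold g, phi.
  clear x hx g ht. rename t into x, ht' into hx.
  assert (0 < 1 - x ^ 2) by nra.
  assert (0 < 1 - y ^ 2) by nra.
  assert (0 < 1 - z ^ 2) by nra.
  (* One jet per factor: all dilogarithm arguments, on both sides, and their complements are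
     quotients of products of these. *)
  get_jet (fun x : R => x) x l d h.
  get_jet (fun _ : R => y) x l d h.
  get_jet (fun _ : R => z) x l d h.
  get_jet (fun x : R => 1 - x ^ 2) x l d h.
  get_jet (fun x : R => 1 - y ^ 2) x l d h.
  get_jet (fun x : R => 1 - z ^ 2) x l d h.
  get_jet (fun x : R => x + y * z) x l d h.
  get_jet (fun x : R => y + x * z) x l d h.
  get_jet (fun x : R => z + x * y) x l d h.
  get_jet (fun x : R => 1 + x * y * z) x l d h.
  get_jet (fun x : R => y + x ^ 2 * y + x * z + x * y ^ 2 * z) x l d h.
  get_jet (fun x : R => z + x ^ 2 * z + x * y + x * z ^ 2 * y) x l d h.
  get_jet (fun x : R => x + y ^ 2 * x + y * z + y * x ^ 2 * z) x l d h.
  get_jet (fun x : R => z + y ^ 2 * z + y * x + y * z ^ 2 * x) x l d h.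
  get_jet (fun x : R => x + z ^ 2 * x + z * y + z * x ^ 2 * y) x l d h.
  get_jet (fun x : R => y + z ^ 2 * y + z * x + z * y ^ 2 * x) x l d h.
  eapply eq_rect with (P := is_derive _ x).
  + apply (is_derive_minus (V := R_NormedModule)).
    * apply is_derive_scal.
      derive_sums.
      -- eapply (is_derive_phi_term (fun x => x) (fun _ => y) (fun _ => z)); find_jet.
      -- eapply (is_derive_phi_term (fun x => x) (fun _ => z) (fun _ => y)); find_jet.
      -- eapply (is_derive_phi_term (fun _ => y) (fun x => x) (fun _ => z)); find_jet.
      -- eapply (is_derive_phi_term (fun _ => y) (fun _ => z) (fun x => x)); find_jet.
      -- eapply (is_derive_phi_term (fun _ => z) (fun x => x) (fun _ => y)); find_jet.
      -- eapply (is_derive_phi_term (fun _ => z) (fun _ => y) (fun x => x)); find_jet.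
    * apply is_derive_scal.
      derive_sums.
      -- eapply (is_derive_summand (fun x => x ^ 2) (fun x => x * y * z));
           [log_jets| | log_jets | |
            apply log_jet_ext with (fun x => x * (x + y * z));
              [intros; ring|log_jets]]; find_jet.
      -- eapply (is_derive_summand (fun _ => y ^ 2) (fun x => x * y * z));
           [apply (log_jet_sqr (fun _ => y)); eassumption| | log_jets | |
            apply log_jet_ext with (fun x => y * (y + x * z));
              [intros; ring|log_jets]]; find_jet.
      -- eapply (is_derive_summand (fun _ => z ^ 2) (fun x => x * y * z));
           [apply (log_jet_sqr (fun _ => z)); eassumption| | log_jets | |
            apply log_jet_ext with (fun x => z * (z + x * y));
              [intros; ring|log_jets]]; find_jet.
  + unfold wedge, minus, plus, opp, scal; simpl. unfold mult; simpl. field.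
- intros t ht. unfold g. apply continuous_Rminus; [apply continuous_phi_1; lra|].
  apply continuous_Rscal.
  apply continuous_Rplus; [apply continuous_Rplus|];
    (apply continuous_summand; [ex_der|ex_der|nonneg]).
Qed.

(** Carries an identity from the open interval to its right end, where the jet of 1 - x does not
    exist. *)
Lemma zero_at_1 (g : R -> R) :
  continuous g 1 -> (forall x, 0 < x < 1 -> g x = 0) -> forall x, 0 < x <= 1 -> g x = 0.
Proof.
intros hc h x [hx [hx1 | ->]]; [apply h; lra|].
rewrite <- (h (1 / 2)) by lra. symmetry.
assert (hx1 : 1 / 2 < 1) by lra.
apply (eq_of_derive_zero g); [lra| |].
- intros t ht. apply is_derive_ext_loc with (fun _ => 0); [|apply @is_derive_const].
  apply filter_imp with (fun x => 0 < x /\ x < 1); [intros s hs; symmetry; now apply h|].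
  apply filter_and; [apply open_gt|apply open_lt]; lra.
- intros t [ht [ht' | ->]]; [|exact hc].
  apply continuous_ext_loc with (fun _ => 0); [|apply continuous_const].
  apply filter_imp with (fun x => 0 < x /\ x < 1); [intros s hs; symmetry; now apply h|].
  apply filter_and; [apply open_gt|apply open_lt]; lra.
Qed.

Theorem phi_closed_form (x y z : R) :
  0 < x <= 1 -> 0 < y <= 1 -> 0 < z <= 1 ->
  phi x y z = 16 * (summand (x ^ 2) (x * y * z) + summand (y ^ 2) (x * y * z)
                    + summand (z ^ 2) (x * y * z)).
Proof.
pose (d := fun x y z => phi x y z - 16 * (summand (x ^ 2) (x * y * z)
   + summand (y ^ 2) (x * y * z) + summand (z ^ 2) (x * y * z))).
(* The symmetry reduces continuity to the first variable; the faces x = 1, y = 1 and z = 1 are then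
   added one at a time. *)
assert (hd : forall x y z, d x y z = d y x z /\ d x y z = d z y x).
{ intros a b c. unfold d. split; [rewrite (phi_swap12 a b c)|rewrite (phi_swap13 a b c)].
  - replace (b * a * c) with (a * b * c) by ring. ring.
  - replace (c * b * a) with (a * b * c) by ring. ring. }
assert (hc : forall y z, 0 < y -> 0 < z -> continuous (fun x : R => d x y z) 1).
{ intros b c hb hc. unfold d. apply continuous_Rminus; [apply continuous_phi_1; lra|].
  apply continuous_Rscal.
  apply continuous_Rplus; [apply continuous_Rplus|];
    (apply continuous_summand; [ex_der|ex_der|nonneg]). }
assert (h0 : forall x y z, 0 < x < 1 -> 0 < y < 1 -> 0 < z < 1 -> d x y z = 0).
{ intros a b c ha hb hc'. unfold d. rewrite phi_closed_form_open by easy. ring. }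
assert (h1 : forall x y z, 0 < x <= 1 -> 0 < y < 1 -> 0 < z < 1 -> d x y z = 0).
{ intros a b c ha hb hc'. apply (zero_at_1 (fun x => d x b c)); [apply hc; lra| |easy].
  intros a' ha'. now apply h0. }
assert (h2 : forall x y z, 0 < x <= 1 -> 0 < y <= 1 -> 0 < z < 1 -> d x y z = 0).
{ intros a b c ha hb hc'. rewrite (proj1 (hd a b c)).
  apply (zero_at_1 (fun x => d x a c)); [apply hc; lra| |easy].
  intros b' hb'. rewrite (proj1 (hd b' a c)). now apply h1. }
intros hx hy hz. assert (e : d x y z = 0); [|unfold d in e; lra].
rewrite (proj2 (hd x y z)).
apply (zero_at_1 (fun z => d z y x)); [apply hc; lra| |easy].
intros z' hz'. rewrite (proj2 (hd z' y x)). now apply h2.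
Qed.

(** * The closed form of eta *)

Definition eta_summand (x r : R) : R :=
  rogersL x + rogersL r + rogersL (x * r / (1 + x * r)) - rogersL ((x + r) / (1 + x * r)).

Lemma continuous_eta_1 (x y : R) : 0 <= x -> 0 < y -> continuous (fun x : R => eta x y) x.
Proof.
intros hx hy. assert (0 < y ^ 2) by pos. unfold eta. cont; ex_der.
Qed.

Lemma continuous_eta_summand_1 (x r : R) :
  0 <= x -> 0 <= r -> continuous (fun x : R => eta_summand x r) x.
Proof.
intros hx hr. unfold eta_summand. cont; ex_der.
Qed.

Lemma eta_summand_0 (r : R) : eta_summand 0 r = 0.
Proof.
unfold eta_summand. rewrite Rmult_0_l, Rplus_0_l, Rplus_0_r.
replace (0 / 1) with 0 by field. rewrite Rdiv_1_r, rogersL_0. ring.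
Qed.

Lemma eta_0 (y : R) : 0 < y -> eta 0 y = 0.
Proof.
intros hy. unfold eta.
assert (0 < 1 + y ^ 2) by pos.
replace ((0 + 1) ^ 2 * y ^ 2 / _) with 1 by (field; lra).
replace ((1 - 0) ^ 2 * y ^ 2 / _) with 1 by (field; lra).
replace ((0 * y ^ 2 + 1) / (1 + y ^ 2)) with ((1 - 0) / (1 + y ^ 2)) by (field; nra).
replace ((0 + y ^ 2) / (0 * y ^ 2 + 1)) with (y ^ 2) by (field; lra).
replace ((1 - y ^ 2) / (1 + 0)) with (1 - y ^ 2) by field.
replace ((0 * y ^ 2 + 1) / (1 + 0)) with 1 by field.
pose proof (rogersL_reflect (y ^ 2)). rewrite rogersL_1. lra.
Qed.

Lemma eta_closed_form_open (x y : R) :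
  0 < x < 1 -> 0 < y < 1 -> eta x y = 16 * eta_summand x (y ^ 2).
Proof.
intros hx hy.
set (g := fun x => eta x y - 16 * eta_summand x (y ^ 2)).
assert (0 < y ^ 2) by pos.
assert (hg : g 0 = g x); [|unfold g in hg].
2: { rewrite eta_0, eta_summand_0 in hg by lra. lra. }
apply eq_of_derive_zero; [lra| |].
- intros t ht. assert (ht' : 0 < t < 1) by lra. unfold g, eta, eta_summand.
  clear x hx g ht. rename t into x, ht' into hx.
  assert (0 < 1 - y ^ 2) by nra.
  get_jet (fun x : R => x) x l d h.
  get_jet (fun _ : R => y ^ 2) x l d h.
  get_jet (fun x : R => 1 - x) x l d h.
  get_jet (fun x : R => 1 + x) x l d h.
  get_jet (fun _ : R => 1 - y ^ 2) x l d h.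
  get_jet (fun _ : R => 1 + y ^ 2) x l d h.
  get_jet (fun x : R => x + y ^ 2) x l d h.
  get_jet (fun x : R => 1 + x * y ^ 2) x l d h.
  eapply eq_rect with (P := is_derive _ x).
  + derive_sums.
    * dilog_quot (fun x => (x + 1) ^ 2 * y ^ 2) (fun x => x * (1 - y ^ 2) ^ 2)
        (fun x => (x + y ^ 2) * (x * y ^ 2 + 1)) x.
    * dilog_quot (fun x => (1 - x) ^ 2 * y ^ 2) (fun x => x * (1 + y ^ 2) ^ 2)
        (fun x => (x + y ^ 2) * (x * y ^ 2 + 1)) x.
    * dilog_quot (fun x => 1 - x) (fun x => x + y ^ 2) (fun _ : R => 1 + y ^ 2) x.
    * dilog_quot (fun x => x * y ^ 2 + 1) (fun x => y ^ 2 * (1 - x))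
        (fun _ : R => 1 + y ^ 2) x.
    * dilog_quot (fun x => x + y ^ 2) (fun x => (1 - x) * (1 - y ^ 2))
        (fun x => x * y ^ 2 + 1) x.
    * dilog_quot (fun _ : R => 1 - y ^ 2) (fun x => x + y ^ 2) (fun x => 1 + x) x.
    * dilog_quot (fun x => x * y ^ 2 + 1) (fun x => x * (1 - y ^ 2)) (fun x => 1 + x) x.
    * eapply (is_derive_rogersL_jet (fun x => x)); log_jets.
    * eapply (is_derive_rogersL_jet (fun _ => y ^ 2)); log_jets.
    * dilog_quot (fun x => x * y ^ 2) (fun _ : R => 1) (fun x => 1 + x * y ^ 2) x.
    * dilog_quot (fun x => x + y ^ 2) (fun x => (1 - x) * (1 - y ^ 2))
        (fun x => 1 + x * y ^ 2) x.
  + unfold wedge, minus, plus, opp, scal; simpl. unfold mult; simpl. field.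
- intros t ht. unfold g. apply continuous_Rminus; [apply continuous_eta_1; lra|].
  apply continuous_Rscal, continuous_eta_summand_1; lra.
Qed.

Lemma zero_at_1_pair (d : R -> R -> R) :
  (forall y, 0 < y <= 1 -> continuous (fun x => d x y) 1) ->
  (forall x, 0 < x <= 1 -> continuous (d x) 1) ->
  (forall x y, 0 < x < 1 -> 0 < y < 1 -> d x y = 0) ->
  forall x y, 0 < x <= 1 -> 0 < y <= 1 -> d x y = 0.
Proof.
intros h1 h2 h x y hx hy.
apply (zero_at_1 (d x)); [now apply h2| |easy]. intros y' hy'.
apply (zero_at_1 (fun x => d x y')); [apply h1; lra| |easy]. intros x' hx'.
now apply h.
Qed.

Theorem eta_closed_form (x y : R) :
  0 < x <= 1 -> 0 < y <= 1 -> eta x y = 16 * eta_summand x (y ^ 2).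
Proof.
intros hx hy. apply Rminus_diag_uniq.
apply (zero_at_1_pair (fun x y => eta x y - 16 * eta_summand x (y ^ 2))); try easy.
- intros b hb. assert (0 < b ^ 2) by pos.
  apply continuous_Rminus; [apply continuous_eta_1; lra|].
  apply continuous_Rscal, continuous_eta_summand_1; lra.
- intros a ha. unfold eta, eta_summand. cont; ex_der.
- intros a b ha hb. rewrite eta_closed_form_open by easy. ring.
Qed.

(** * The difference of eta and phi at y = z *)

Definition gap_angle_form (x r : R) : R :=
  rogersL ((1 + x) ^ 2 * r / ((x + r) * (1 + x * r)))
  - rogersL (r / (x + r)) - rogersL (x * r / (1 + x * r)).

(** Starting from the closed forms keeps the list of factors short: x^2 + xr = x (x + r) and r + xr
    = r (1 + x), so seven jets suffice. *)
Lemma gap_closed_form_open (x r : R) :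
  0 < x < 1 -> 0 < r < 1 ->
  2 * (eta_summand x r - summand (x ^ 2) (x * r) - 2 * summand r (x * r))
  = gap_angle_form x r.
Proof.
intros hx hr.
set (g := fun x => 2 * (eta_summand x r - summand (x ^ 2) (x * r)
  - 2 * summand r (x * r)) - gap_angle_form x r).
assert (hg : g 0 = g x); [|unfold g in hg].
2: { rewrite eta_summand_0 in hg. rewrite Rmult_0_l, !summand_0_r in hg.
     unfold gap_angle_form at 1 in hg.
     replace ((1 + 0) ^ 2 * r / _) with 1 in hg by (field; lra).
     replace (r / (0 + r)) with 1 in hg by (field; lra).
     replace (0 * r / _) with 0 in hg by (field; lra).
     rewrite rogersL_0 in hg. lra. }
apply eq_of_derive_zero; [lra| |].
- intros t ht. assert (ht' : 0 < t < 1) by lra. unfold g, eta_summand, gap_angle_form.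
  clear x hx g ht. rename t into x, ht' into hx.
  get_jet (fun x : R => x) x l d h.
  get_jet (fun _ : R => r) x l d h.
  get_jet (fun x : R => 1 - x) x l d h.
  get_jet (fun x : R => 1 + x) x l d h.
  get_jet (fun _ : R => 1 - r) x l d h.
  get_jet (fun x : R => x + r) x l d h.
  get_jet (fun x : R => 1 + x * r) x l d h.
  eapply eq_rect with (P := is_derive _ x).
  + derive_sums.
    * eapply (is_derive_rogersL_jet (fun x => x)); log_jets.
    * eapply (is_derive_rogersL_jet (fun _ => r)); log_jets.
    * dilog_quot (fun x => x * r) (fun _ : R => 1) (fun x => 1 + x * r) x.
    * dilog_quot (fun x => x + r) (fun x => (1 - x) * (1 - r)) (fun x => 1 + x * r) x.
    * eapply (is_derive_summand (fun x => x ^ 2) (fun x => x * r));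
        [log_jets| |log_jets|log_jets|].
      -- apply log_jet_ext with (fun x => (1 - x) * (1 + x)); [intros; ring|log_jets].
      -- apply log_jet_ext with (fun x => x * (x + r)); [intros; ring|log_jets].
    * eapply (is_derive_summand (fun _ => r) (fun x => x * r));
        [log_jets|log_jets|log_jets|log_jets|].
      apply log_jet_ext with (fun x => r * (1 + x)); [intros; ring|log_jets].
    * dilog_quot (fun x => (1 + x) ^ 2 * r) (fun x => x * (1 - r) ^ 2)
        (fun x => (x + r) * (1 + x * r)) x.
    * dilog_quot (fun _ : R => r) (fun x : R => x) (fun x => x + r) x.
    * dilog_quot (fun x => x * r) (fun _ : R => 1) (fun x => 1 + x * r) x.
  + unfold wedge, minus, plus, opp, scal; simpl. unfold mult; simpl. field.
- intros t ht. unfold g, eta_summand, summand, gap_angle_form. cont; ex_der.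
Qed.

Theorem gap_closed_form (x y : R) :
  0 < x <= 1 -> 0 < y <= 1 -> eta x y - phi x y y = 8 * gap_angle_form x (y ^ 2).
Proof.
intros hx hy. rewrite eta_closed_form, phi_closed_form by easy.
replace (x * y * y) with (x * y ^ 2) by ring.
assert (hy2 : 0 < y ^ 2 <= 1) by nra.
assert (e : 2 * (eta_summand x (y ^ 2) - summand (x ^ 2) (x * y ^ 2)
   - 2 * summand (y ^ 2) (x * y ^ 2)) - gap_angle_form x (y ^ 2) = 0); [|lra].
apply (zero_at_1_pair (fun x r => 2 * (eta_summand x r - summand (x ^ 2) (x * r)
   - 2 * summand r (x * r)) - gap_angle_form x r)); try easy.
- intros b hb. unfold eta_summand, summand, gap_angle_form. cont; ex_der.
- intros a ha. unfold eta_summand, summand, gap_angle_form. cont; ex_der.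
- intros a b ha hb. rewrite gap_closed_form_open by easy. ring.
Qed.

(** * Monotonicity and convexity of the summands *)

Lemma log_jet_of_derive (f : R -> R) (t f' d : R) :
  0 < f t -> is_derive f t f' -> f' = f t * d -> log_jet f t (ln (f t)) d.
Proof. intros h1 h2 ->. split; [|split]; easy. Qed.

Ltac jet f t d h :=
  pose proof (log_jet_of_derive f t _ d ltac:(cbv beta; pos)
    ltac:(cbv beta; auto_derive; [easy|reflexivity]) ltac:(cbv beta; field; lra)) as h;
  cbv beta in h.

(** Twice the derivative of [summand] with respect to ln s. *)
Definition slope_s (s u : R) : R :=
  s / (1 - s) * (ln (s + u) - ln s - ln (1 + u)) - ln (1 - s) * (u / (s + u))
  - ln (1 + u) * (s / (s + u)).

Lemma is_derive_summand_s (s u : R) :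
  0 < s < 1 -> 0 < u -> is_derive (fun s => summand s u) s (slope_s s u / (2 * s)).
Proof.
intros hs hu.
jet (fun x : R => x) s (/ s) h1.
jet (fun x : R => 1 - x) s (- / (1 - s)) h2.
jet (fun _ : R => u) s 0 h3.
jet (fun _ : R => 1 + u) s 0 h4.
jet (fun x : R => x + u) s (/ (s + u)) h5.
replace (slope_s s u / (2 * s)) with
  (wedge (ln s) (/ s) (ln (1 - s)) (- / (1 - s))
   + wedge (ln u - ln (1 + u)) (0 - 0) (- ln (1 + u)) (- 0)
   - wedge (ln (s + u) - ln (1 + u)) (/ (s + u) - 0)
       (ln (1 - s) - ln (1 + u)) (- / (1 - s) - 0))
  by (unfold wedge, slope_s; field; lra).
apply (is_derive_summand (fun x => x) (fun _ => u)); easy.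
Qed.

Lemma ln_ratio_bound (s u : R) :
  0 < s < 1 -> 0 < u ->
  u * (1 - s) / (s + u) <= ln (s + u) - ln s - ln (1 + u).
Proof.
intros hs hu.
pose proof (ln_ge_1_sub_inv ((s + u) / (s * (1 + u))) ltac:(apply Rdiv_lt_0_compat; pos)) as h.
rewrite ln_div, ln_mult in h by pos.
replace (1 - / ((s + u) / (s * (1 + u)))) with (u * (1 - s) / (s + u)) in h
  by (field; lra).
lra.
Qed.

(** All three terms are compared with w = su/(s + u): the first two contribute at least w each, and
    the last one takes away at most w. *)
Lemma slope_s_pos (s u : R) : 0 < s < 1 -> 0 < u -> 0 < slope_s s u.
Proof.
intros hs hu. unfold slope_s.
pose proof (ln_ratio_bound s u hs hu) as h1.
pose proof (ln_le_sub1 (1 - s) ltac:(lra)) as h2.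
pose proof (ln_le_sub1 (1 + u) ltac:(lra)) as h3.
assert (hp : 0 < s * u / (s + u)) by (apply Rdiv_lt_0_compat; pos).
assert (a1 : s * u / (s + u) <= s / (1 - s) * (ln (s + u) - ln s - ln (1 + u))).
{ replace (s * u / (s + u)) with (s / (1 - s) * (u * (1 - s) / (s + u))) by (field; lra).
  apply Rmult_le_compat_l; [apply Rlt_le, Rdiv_lt_0_compat; lra|easy]. }
assert (a2 : s * u / (s + u) <= - ln (1 - s) * (u / (s + u))).
{ replace (s * u / (s + u)) with (s * (u / (s + u))) by (field; lra).
  apply Rmult_le_compat_r; [apply Rlt_le, Rdiv_lt_0_compat; lra|lra]. }
assert (a3 : ln (1 + u) * (s / (s + u)) <= s * u / (s + u)).
{ replace (s * u / (s + u)) with (u * (s / (s + u))) by (field; lra).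
  apply Rmult_le_compat_r; [apply Rlt_le, Rdiv_lt_0_compat; lra|lra]. }
lra.
Qed.

Lemma continuous_summand_s (s u : R) :
  0 <= u -> continuous (fun s : R => summand s u) s.
Proof. intros hu. apply continuous_summand; [ex_der|ex_der|easy]. Qed.

Lemma summand_lt_s (s t u : R) :
  0 <= s -> s < t -> t <= 1 -> 0 < u -> summand s u < summand t u.
Proof.
intros hs hst ht hu.
apply (increasing_of_derive_pos (fun s => summand s u) (fun s => slope_s s u / (2 * s)));
  [easy| | |].
- intros x hx. apply is_derive_summand_s; lra.
- intros x _. apply continuous_summand_s. lra.
- intros x hx. apply Rdiv_lt_0_compat; [apply slope_s_pos|]; lra.
Qed.

(* With v = (s + u)/(1 + u), the claim below reduces to v >= (1 - v) ln (1/(1 - v)). *)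
Lemma slope_s_derive (s u : R) :
  0 < s < 1 -> 0 < u ->
  exists d, is_derive (fun s => slope_s s u) s d /\ 0 <= d.
Proof.
intros hs hu.
exists ((ln (s + u) - ln s - ln (1 + u)) / (1 - s) ^ 2
        + u * (ln (1 - s) - ln (1 + u)) / (s + u) ^ 2).
split.
- unfold slope_s. auto_derive; [repeat split; lra|]. unfold Rminus. field. lra.
- pose proof (ln_ratio_bound s u hs hu) as h1.
  pose proof (ln_ge_1_sub_inv ((1 - s) / (1 + u)) ltac:(apply Rdiv_lt_0_compat; lra)) as h2.
  rewrite ln_div in h2 by lra.
  replace (1 - / ((1 - s) / (1 + u))) with (- (s + u) / (1 - s)) in h2 by (field; lra).
  apply Rle_trans with (u * (1 - s) / (s + u) / (1 - s) ^ 2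
                        + u * (- (s + u) / (1 - s)) / (s + u) ^ 2).
  + apply Req_le. field. lra.
  + apply Rplus_le_compat.
    * apply Rmult_le_compat_r; [apply Rlt_le, Rinv_0_lt_compat, pow_lt; lra|easy].
    * apply Rmult_le_compat_r; [apply Rlt_le, Rinv_0_lt_compat, pow_lt; lra|].
      apply Rmult_le_compat_l; lra.
Qed.

Lemma slope_s_le (s t u : R) :
  0 < s -> s <= t -> t < 1 -> 0 < u -> slope_s s u <= slope_s t u.
Proof.
intros hs hst ht hu.
assert (hd : forall x, 0 < x < 1 ->
  is_derive (fun s => slope_s s u) x (Derive (fun s => slope_s s u) x)
  /\ 0 <= Derive (fun s => slope_s s u) x).
{ intros x hx. destruct (slope_s_derive x u hx hu) as [d [h1 h2]].
  assert (e : Derive (fun s : R => slope_s s u) x = d) by now apply is_derive_unique.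
  rewrite e. now split. }
apply (nondecreasing_of_derive_nonneg (fun s => slope_s s u)
  (Derive (fun s => slope_s s u))); [easy| | |].
- intros x hx. apply hd. lra.
- intros x hx. apply (ex_derive_continuous (fun s => slope_s s u)).
  eexists. apply hd. lra.
- intros x hx. apply hd. lra.
Qed.

(* [summand] is convex as a function of [ln s]. *)
Lemma summand_ge_tangent (s s0 u : R) :
  0 < s <= 1 -> 0 < s0 < 1 -> 0 < u ->
  summand s0 u + slope_s s0 u / 2 * (ln s - ln s0) <= summand s u.
Proof.
intros hs hs0 hu.
set (c := slope_s s0 u / 2).
assert (hd : forall x, 0 < x < 1 ->
  is_derive (fun x => summand x u - c * ln x) x ((slope_s x u - slope_s s0 u) / (2 * x))).
{ intros x hx.
  replace (_ / (2 * x)) with (slope_s x u / (2 * x) - c * / x) by (unfold c; field; lra).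
  apply (is_derive_minus (V := R_NormedModule)); [now apply is_derive_summand_s|].
  apply is_derive_scal. auto_derive; [easy|field; lra]. }
assert (hc : forall x, 0 < x -> continuous (fun x => summand x u - c * ln x) x).
{ intros x hx. apply continuous_Rminus; [apply continuous_summand_s; lra|].
  apply continuous_Rscal. apply (ex_derive_continuous ln). auto_derive. easy. }
destruct (Rle_lt_dec s0 s) as [h|h].
- assert (summand s0 u - c * ln s0 <= summand s u - c * ln s); [|lra].
  apply (nondecreasing_of_derive_nonneg (fun x => summand x u - c * ln x)
    (fun x => (slope_s x u - slope_s s0 u) / (2 * x))); [easy| | |].
  + intros x hx. apply hd. lra.
  + intros x hx. apply hc. lra.
  + intros x hx. pose proof (slope_s_le s0 x u ltac:(lra) ltac:(lra) ltac:(lra) hu).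
    apply Rdiv_le_0_compat; lra.
- assert (- (summand s u - c * ln s) <= - (summand s0 u - c * ln s0)); [|lra].
  apply (nondecreasing_of_derive_nonneg (fun x => - (summand x u - c * ln x))
    (fun x => - ((slope_s x u - slope_s s0 u) / (2 * x)))); [lra| | |].
  + intros x hx. apply (is_derive_opp (V := R_NormedModule)), hd. lra.
  + intros x hx. apply (continuous_opp (V := R_NormedModule)), hc. lra.
  + intros x hx. pose proof (slope_s_le x s0 u ltac:(lra) ltac:(lra) ltac:(lra) hu).
    replace (- _) with ((slope_s s0 u - slope_s x u) / (2 * x)) by (field; lra).
    apply Rdiv_le_0_compat; lra.
Qed.

(** Twice the derivative of [summand] with respect to ln u. *)
Definition slope_u (s u : R) : R :=
  ln (1 + u) + u / (1 + u) * (ln (s + u) - ln (1 + u) - ln u)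
  + (ln (1 - s) - ln (1 + u)) * (u * (1 - s) / ((s + u) * (1 + u))).

Lemma is_derive_summand_u (s u : R) :
  0 < s < 1 -> 0 < u -> is_derive (fun u => summand s u) u (slope_u s u / (2 * u)).
Proof.
intros hs hu.
jet (fun _ : R => s) u 0 h1.
jet (fun _ : R => 1 - s) u 0 h2.
jet (fun x : R => x) u (/ u) h3.
jet (fun x : R => 1 + x) u (/ (1 + u)) h4.
jet (fun x : R => s + x) u (/ (s + u)) h5.
replace (slope_u s u / (2 * u)) with
  (wedge (ln s) 0 (ln (1 - s)) 0
   + wedge (ln u - ln (1 + u)) (/ u - / (1 + u)) (- ln (1 + u)) (- / (1 + u))
   - wedge (ln (s + u) - ln (1 + u)) (/ (s + u) - / (1 + u))
       (ln (1 - s) - ln (1 + u)) (0 - / (1 + u)))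
  by (unfold wedge, slope_u; field; lra).
apply (is_derive_summand (fun _ => s) (fun x => x)); easy.
Qed.

Lemma one_sub_mul_ln_ge (s : R) : 0 < s < 1 -> - s <= (1 - s) * ln (1 - s).
Proof.
intros hs. pose proof (ln_ge_1_sub_inv (1 - s) ltac:(lra)) as h.
replace (- s) with ((1 - s) * (1 - / (1 - s))) by (field; lra).
apply Rmult_le_compat_l; lra.
Qed.

(** The condition u^2 <= s says u (1 + u) <= s + u, which makes ln(s + u) - ln(1 + u) - ln u
    nonnegative. In the remaining part the bounds ln(1 + u) >= u/(1 + u) and (1 - s) ln(1 - s) >= -s
    reduce the claim to u^2 + s + 2us > s + su. *)
Lemma slope_u_pos (s u : R) : 0 < s < 1 -> 0 < u -> u ^ 2 <= s -> 0 < slope_u s u.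
Proof.
intros hs hu hus.
pose proof (ln_ge_1_sub_inv (1 + u) ltac:(lra)) as h1.
pose proof (one_sub_mul_ln_ge s hs) as h2.
assert (h3 : 0 <= ln (s + u) - ln (1 + u) - ln u).
{ assert (ln ((1 + u) * u) <= ln (s + u)) by (apply ln_le; nra).
  rewrite ln_mult in H by lra. lra. }
assert (hD : 0 < (s + u) * (1 + u)) by pos.
replace (slope_u s u) with
  (u / (1 + u) * (ln (s + u) - ln (1 + u) - ln u)
   + (ln (1 + u) * (u ^ 2 + s + 2 * u * s) + u * ((1 - s) * ln (1 - s)))
     / ((s + u) * (1 + u))) by (unfold slope_u; field; lra).
apply Rplus_le_lt_0_compat.
- apply Rmult_le_pos; [apply Rdiv_le_0_compat; lra|easy].
- apply Rdiv_lt_0_compat; [|easy].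
  assert (e : 1 - / (1 + u) = u / (1 + u)) by (field; lra).
  assert (a1 : u / (1 + u) * (u ^ 2 + s + 2 * u * s)
               <= ln (1 + u) * (u ^ 2 + s + 2 * u * s)).
  { apply Rmult_le_compat_r; [nra|lra]. }
  assert (a2 : u * s < u / (1 + u) * (u ^ 2 + s + 2 * u * s)).
  { replace (u * s) with (u / (1 + u) * (s + s * u)) by (field; lra).
    apply Rmult_lt_compat_l; [apply Rdiv_lt_0_compat; lra|nra]. }
  nra.
Qed.

Lemma summand_le_u (s u v : R) :
  0 < s <= 1 -> 0 < u -> u <= v -> v <= 1 -> v ^ 2 <= s -> summand s u <= summand s v.
Proof.
intros [hs [hs1 | ->]] hu huv hv hvs.
- apply (nondecreasing_of_derive_nonneg (fun u => summand s u)
    (fun u => slope_u s u / (2 * u))); [easy| | |].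
  + intros x hx. apply is_derive_summand_u; lra.
  + intros x hx. apply (continuous_summand (fun _ => s) (fun x => x)); [ex_der|ex_der|lra].
  + intros x hx. apply Rlt_le, Rdiv_lt_0_compat; [apply slope_u_pos; nra|lra].
- unfold summand. replace ((1 + u) / (1 + u)) with 1 by (field; lra).
  replace ((1 + v) / (1 + v)) with 1 by (field; lra).
  assert (rogersL (u / (1 + u)) <= rogersL (v / (1 + v))); [|lra].
  apply rogersL_le.
  + apply Rdiv_le_0_compat; lra.
  + apply Rle_div_l; [lra|]. replace (v / (1 + v) * (1 + u)) with (v * (1 + u) / (1 + v))
      by (field; lra). apply Rle_div_r; nra.
  + apply Rle_div_l; lra.
Qed.

(** The order of the two moves matters. First x^2 is raised to x'^2 at fixed u, which gives the
    strict inequality; then u is raised. Growth in u needs u^2 <= s, which x'yz <= x' ensures at s =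
    x'^2 but which can fail at s = x^2. *)
Lemma phi_lt_1 (x x' y z : R) :
  0 < x -> x < x' -> x' <= 1 -> 0 < y <= 1 -> 0 < z <= 1 -> phi x y z < phi x' y z.
Proof.
intros hx hxx hx' hy hz. rewrite !phi_closed_form by lra.
assert (hyz : 0 < y * z <= 1) by (split; [pos|nra]).
assert (h0 : 0 < x * y * z) by pos.
assert (h1 : x * y * z <= x' * y * z) by nra.
assert (a1 : x' * y * z <= x') by nra.
assert (hxz : 0 < x' * z <= 1) by (split; [pos|nra]).
assert (hxy : 0 < x' * y <= 1) by (split; [pos|nra]).
assert (a2 : x' * y * z <= y) by nra.
assert (a3 : x' * y * z <= z) by nra.
assert (b : forall w, 0 < w <= 1 -> x' * y * z <= w ->
  summand (w ^ 2) (x * y * z) <= summand (w ^ 2) (x' * y * z)).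
{ intros w hw hw'. apply summand_le_u; try lra; [nra|apply pow_incr; lra]. }
pose proof (b x' ltac:(lra) a1). pose proof (b y hy a2). pose proof (b z hz a3).
pose proof (summand_lt_s (x ^ 2) (x' ^ 2) (x * y * z) ltac:(nra) ltac:(nra)
  ltac:(nra) h0).
lra.
Qed.

(** Both sides share the same u = t^3. The three tangents are taken at the same point ln t^2, so
    they have one slope, and their linear parts cancel because ln x + ln y + ln z = 3 ln t. *)
Theorem phi_ge_diagonal (x y z t : R) :
  0 < x <= 1 -> 0 < y <= 1 -> 0 < z <= 1 -> 0 < t < 1 -> t ^ 3 = x * y * z ->
  phi t t t <= phi x y z.
Proof.
intros hx hy hz ht e. rewrite !phi_closed_form by lra.
replace (t * t * t) with (t ^ 3) by ring. rewrite <- e.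
assert (ht3 : 0 < t ^ 3) by pos.
assert (ht2 : 0 < t ^ 2 < 1) by nra.
pose proof (summand_ge_tangent (x ^ 2) (t ^ 2) (t ^ 3) ltac:(nra) ht2 ht3) as h1.
pose proof (summand_ge_tangent (y ^ 2) (t ^ 2) (t ^ 3) ltac:(nra) ht2 ht3) as h2.
pose proof (summand_ge_tangent (z ^ 2) (t ^ 2) (t ^ 3) ltac:(nra) ht2 ht3) as h3.
apply (f_equal ln) in e. rewrite !ln_mult in e by pos.
rewrite !ln_pow in * by lra. simpl INR in *.
assert (e' : ln x + ln y + ln z = 3 * ln t) by lra.
set (c := slope_s (t ^ 2) (t ^ 3) / 2) in *.
assert (c * ((1 + 1) * ln x - (1 + 1) * ln t) + c * ((1 + 1) * ln y - (1 + 1) * ln t)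
  + c * ((1 + 1) * ln z - (1 + 1) * ln t) = 0); [|lra].
replace (ln x) with (3 * ln t - ln y - ln z) by lra. ring.
Qed.

(** * Monotonicity of eta *)

(** Twice the derivative of [eta_summand] with respect to ln x; [K] is the derivative of ln((x +
    r)/(1 + xr)) with respect to ln x. *)
Definition eta_slope (x r : R) : R :=
  let K := x * (1 - r ^ 2) / ((x + r) * (1 + x * r)) in
  x / (1 - x) * (ln (x + r) - ln x - ln (1 + x * r))
  + x * r / (1 + x * r) * (ln (x + r) - ln (1 + x * r) - ln x - ln r)
  - ln (1 - x) * (1 - K) + ln (1 + x * r) * (1 - K) + ln (1 - r) * K.

Lemma is_derive_eta_summand (x r : R) :
  0 < x < 1 -> 0 < r < 1 ->
  is_derive (fun x => eta_summand x r) x (eta_slope x r / (2 * x)).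
Proof.
intros hx hr. assert (hm : 0 < x * r) by pos.
jet (fun x : R => x) x (/ x) h1.
jet (fun _ : R => r) x 0 h2.
jet (fun x : R => 1 - x) x (- / (1 - x)) h3.
jet (fun _ : R => 1 - r) x 0 h4.
jet (fun x : R => x + r) x (/ (x + r)) h5.
jet (fun x : R => 1 + x * r) x (r / (1 + x * r)) h6.
unfold eta_summand.
eapply eq_rect with (P := is_derive _ x).
- derive_sums.
  + eapply (is_derive_rogersL_jet (fun x => x)); log_jets.
  + eapply (is_derive_rogersL_jet (fun _ => r)); log_jets.
  + dilog_quot (fun x => x * r) (fun _ : R => 1) (fun x => 1 + x * r) x.
  + dilog_quot (fun x => x + r) (fun x => (1 - x) * (1 - r)) (fun x => 1 + x * r) x.
- unfold wedge, eta_slope, minus, plus, opp; simpl. field. lra.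
Qed.

(** Only the term ln(1 - r) K is negative. Measured in units of e = xr/((x + r)(1 + xr)) it is at
    least -(1 + r), while the first and third terms bring at least (1 + x)(1 + xr) and 1 + x^2 +
    2xr. *)
Lemma eta_slope_pos (x r : R) : 0 < x < 1 -> 0 < r < 1 -> 0 < eta_slope x r.
Proof.
intros hx hr. assert (hm : 0 < x * r) by pos.
assert (hD : 0 < (x + r) * (1 + x * r)) by pos.
set (K := x * (1 - r ^ 2) / ((x + r) * (1 + x * r))).
assert (eK : 1 - K = r * (1 + x ^ 2 + 2 * (x * r)) / ((x + r) * (1 + x * r)))
  by (unfold K; field; lra).
assert (hK : 0 <= 1 - K) by (rewrite eK; apply Rdiv_le_0_compat; [nonneg|easy]).
set (e := x * r / ((x + r) * (1 + x * r))).
assert (he : 0 < e) by now apply Rdiv_lt_0_compat.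
assert (a1 : e * ((1 + x) * (1 + x * r))
             <= x / (1 - x) * (ln (x + r) - ln x - ln (1 + x * r))).
{ pose proof (ln_ge_1_sub_inv ((x + r) / (x * (1 + x * r)))
    ltac:(apply Rdiv_lt_0_compat; pos)) as h.
  rewrite ln_div, ln_mult in h by pos.
  replace (e * ((1 + x) * (1 + x * r)))
    with (x / (1 - x) * (1 - / ((x + r) / (x * (1 + x * r)))))
    by (unfold e; field; lra).
  apply Rmult_le_compat_l; [apply Rdiv_le_0_compat; lra|lra]. }
assert (a2 : 0 <= x * r / (1 + x * r) * (ln (x + r) - ln (1 + x * r) - ln x - ln r)).
{ apply Rmult_le_pos; [apply Rdiv_le_0_compat; lra|].
  assert (x * r <= x) by nra. assert (x * r <= r) by nra.
  assert (x * r * (x * r) <= x * r) by nra.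
  assert (h : ln ((1 + x * r) * (x * r)) <= ln (x + r)) by (apply ln_le; nra).
  rewrite !ln_mult in h by pos. lra. }
assert (a3 : e * (1 + x ^ 2 + 2 * (x * r)) <= - ln (1 - x) * (1 - K)).
{ replace (e * _) with (x * (1 - K)) by (rewrite eK; unfold e; field; lra).
  pose proof (ln_le_sub1 (1 - x) ltac:(lra)).
  apply Rmult_le_compat_r; lra. }
assert (a4 : 0 <= ln (1 + x * r) * (1 - K)).
{ apply Rmult_le_pos; [|easy]. rewrite <- ln_1. apply ln_le; lra. }
assert (a5 : - (e * (1 + r)) <= ln (1 - r) * K).
{ pose proof (one_sub_mul_ln_ge r hr).
  replace (- (e * (1 + r))) with (x * (1 + r) / ((x + r) * (1 + x * r)) * - r)
    by (unfold e; field; lra).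
  replace (ln (1 - r) * K)
    with (x * (1 + r) / ((x + r) * (1 + x * r)) * ((1 - r) * ln (1 - r)))
    by (unfold K; field; lra).
  apply Rmult_le_compat_l; [apply Rdiv_le_0_compat; [nonneg|easy]|easy]. }
assert (0 < e * ((1 + x) * (1 + x * r)) + e * (1 + x ^ 2 + 2 * (x * r)) - e * (1 + r)).
{ replace (_ - _) with (e * (x + x ^ 2 + 3 * (x * r) + x * (x * r) + (1 - r)))
    by ring. pos. }
unfold eta_slope. fold K. lra.
Qed.

Lemma eta_summand_lt (x x' r : R) :
  0 < x -> x < x' -> x' <= 1 -> 0 < r <= 1 -> eta_summand x r < eta_summand x' r.
Proof.
intros hx hxx hx' [hr [hr1 | ->]].
- apply (increasing_of_derive_pos (fun x => eta_summand x r)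
    (fun x => eta_slope x r / (2 * x))); [easy| | |].
  + intros t ht. apply is_derive_eta_summand; lra.
  + intros t ht. apply continuous_eta_summand_1; lra.
  + intros t ht. apply Rdiv_lt_0_compat; [apply eta_slope_pos|]; lra.
- unfold eta_summand. rewrite !Rmult_1_r.
  replace ((x + 1) / (1 + x)) with 1 by (field; lra).
  replace ((x' + 1) / (1 + x')) with 1 by (field; lra).
  assert (rogersL x < rogersL x') by (apply rogersL_lt; lra).
  assert (rogersL (x / (1 + x)) < rogersL (x' / (1 + x'))); [|lra].
  apply rogersL_lt.
  + apply Rdiv_le_0_compat; lra.
  + apply Rlt_div_l; [lra|]. replace (x' / (1 + x') * (1 + x)) with (x' * (1 + x) / (1 + x'))
      by (field; lra). apply Rlt_div_r; nra.
  + apply Rle_div_l; lra.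
Qed.

(** Through the closed form, this symmetry turns monotonicity of [eta] in x into monotonicity in
    y. *)
Lemma eta_summand_sym (x r : R) : eta_summand x r = eta_summand r x.
Proof. unfold eta_summand. rewrite (Rmult_comm r x), (Rplus_comm r x). ring. Qed.

Lemma eta_lt_1 (x x' y : R) :
  0 < x -> x < x' -> x' <= 1 -> 0 < y <= 1 -> eta x y < eta x' y.
Proof.
intros hx hxx hx' hy. rewrite !eta_closed_form by lra.
pose proof (eta_summand_lt x x' (y ^ 2) hx hxx hx' ltac:(nra)). lra.
Qed.

Lemma eta_lt_2 (x y y' : R) :
  0 < x <= 1 -> 0 < y -> y < y' -> y' <= 1 -> eta x y < eta x y'.
Proof.
intros hx hy hyy hy'. rewrite !eta_closed_form by lra.
rewrite (eta_summand_sym x (y ^ 2)), (eta_summand_sym x (y' ^ 2)).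
pose proof (eta_summand_lt (y ^ 2) (y' ^ 2) x ltac:(nra) ltac:(nra) ltac:(nra) hx). lra.
Qed.

(** * Superadditivity of the dilogarithm of a squared sine *)

(** At c = cos^2 x this decides the sign of the derivative of [sine_slope] before pi/4. *)
Lemma entropy_skew (c : R) : 1 / 2 <= c < 1 -> (1 - c) * ln (1 - c) <= c * ln c.
Proof.
intros [[hc | <-] hc1].
2: { replace (1 - 1 / 2) with (1 / 2) by field. lra. }
set (k := fun c => c * ln c - (1 - c) * ln (1 - c)).
assert (hd : forall x, 0 < x < 1 -> is_derive k x (ln (x * (1 - x)) + 2)).
{ intros x hx. rewrite ln_mult by lra. unfold k.
  auto_derive; [lra|unfold Rminus; field; lra]. }
assert (hcont : forall x, 0 < x < 1 -> continuous k x).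
{ intros x hx. apply (ex_derive_continuous k). eexists. now apply hd. }
destruct (Rle_lt_dec 0 (k c)) as [h|h]; [unfold k in h; lra|exfalso].
(* [k] vanishes at both ends of [1/2, 1] and [k'] is decreasing there. *)
set (c' := Rmax ((1 + c) / 2) (1 + k c / 2)).
assert (hc' : c < c' < 1).
{ unfold c'. split; [apply Rlt_le_trans with (2 := Rmax_l _ _); lra|].
  apply Rmax_lub_lt; lra. }
(* [c'] replaces the limit at 1: k c' >= c' - 1 >= k c / 2 > k c. Thus [k] would fall from 0 to k c
   and rise again, against the decrease of its derivative. *)
assert (hkc' : k c < k c').
{ assert (1 + k c / 2 <= c') by apply Rmax_r.
  pose proof (ln_ge_1_sub_inv c' ltac:(lra)).
  assert (c' * (1 - / c') = c' - 1) by (field; lra).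
  assert (c' * (1 - / c') <= c' * ln c') by (apply Rmult_le_compat_l; lra).
  pose proof (ln_le_sub1 (1 - c') ltac:(lra)).
  assert (0 <= (1 - c') * - ln (1 - c')) by (apply Rmult_le_pos; lra).
  unfold k at 2. lra. }
destruct (MVT_open k (fun x => ln (x * (1 - x)) + 2) (1 / 2) c) as [a [ha ea]]; [easy| | |].
{ intros x hx. apply hd. lra. }
{ intros x hx. apply hcont. lra. }
destruct (MVT_open k (fun x => ln (x * (1 - x)) + 2) c c') as [b [hb eb]]; [easy| | |].
{ intros x hx. apply hd. lra. }
{ intros x hx. apply hcont. lra. }
assert (hk : k (1 / 2) = 0).
{ unfold k. replace (1 - 1 / 2) with (1 / 2) by field. ring. }
assert (ln (b * (1 - b)) <= ln (a * (1 - a))) by (apply ln_le; nra).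
cbv beta in ea, eb.
assert (0 < ln (b * (1 - b)) + 2).
{ apply (Rmult_lt_reg_r (c' - c)); lra. }
assert (0 < (ln (a * (1 - a)) + 2) * (c - 1 / 2)) by (apply Rmult_lt_0_compat; lra).
lra.
Qed.

Definition sine_slope (th : R) : R :=
  - 2 * (ln (sin th) * (sin th / cos th) + ln (cos th) * (cos th / sin th)).

Lemma is_derive_rogersL_sin2 (th : R) :
  0 < th < PI / 2 -> is_derive (fun th => rogersL (sin th ^ 2)) th (sine_slope th).
Proof.
intros h.
assert (hs : 0 < sin th) by (apply sin_gt_0; lra).
assert (hc : 0 < cos th) by (apply cos_gt_0; lra).
jet (fun x : R => sin x) th (cos th / sin th) h1.
jet (fun x : R => cos x) th (- sin th / cos th) h2.
eapply eq_rect with (P := is_derive _ th).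
- eapply (is_derive_rogersL_jet (fun th => sin th ^ 2)); [log_jets|].
  apply log_jet_ext with (fun x => cos x ^ 2); [|log_jets].
  intros x. pose proof (sin2_cos2 x) as e. unfold Rsqr in e. lra.
- unfold wedge, sine_slope; simpl. field. lra.
Qed.

Lemma sine_slope_refl (th : R) : sine_slope (PI / 2 - th) = sine_slope th.
Proof. unfold sine_slope. rewrite sin_shift, cos_shift. ring. Qed.

Lemma sine_slope_le (a b : R) :
  0 < a -> a <= b -> b <= PI / 4 -> sine_slope a <= sine_slope b.
Proof.
intros ha hab hb. pose proof PI_RGT_0 as hpi.
assert (hd : forall x, 0 < x <= PI / 4 -> is_derive sine_slope x
  (2 * (ln (cos x) / sin x ^ 2 - ln (sin x) / cos x ^ 2))).
{ intros x hx.
  assert (hs : 0 < sin x) by (apply sin_gt_0; lra).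
  assert (hc : 0 < cos x) by (apply cos_gt_0; lra).
  pose proof (sin2_cos2 x) as e. unfold Rsqr in e.
  unfold sine_slope. auto_derive; [repeat split; lra|].
  generalize (ln (sin x)) (ln (cos x)). intros ls lc.
  (* The factor sin^2 + cos^2 is written out so that the first equality is purely rational; the
     Pythagorean identity enters only in the second. *)
  transitivity (2 * (lc * (sin x * sin x + cos x * cos x) / sin x ^ 2
                     - ls * (sin x * sin x + cos x * cos x) / cos x ^ 2)).
  - field. lra.
  - rewrite e. field. lra. }
apply (nondecreasing_of_derive_nonneg sine_slope
  (fun x => 2 * (ln (cos x) / sin x ^ 2 - ln (sin x) / cos x ^ 2))); [easy| | |].
- intros x hx. apply hd. lra.
- intros x hx. apply (ex_derive_continuous sine_slope). eexists. apply hd. lra.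
- intros x hx.
  assert (hs : 0 < sin x) by (apply sin_gt_0; lra).
  assert (hc : 0 < cos x) by (apply cos_gt_0; lra).
  assert (hsc : sin x < cos x).
  { rewrite <- sin_shift. apply sin_increasing_1; lra. }
  pose proof (sin2_cos2 x) as e. unfold Rsqr in e.
  pose proof (entropy_skew (cos x ^ 2) ltac:(nra)) as h.
  replace (1 - cos x ^ 2) with (sin x ^ 2) in h by lra.
  rewrite !ln_pow in h by easy. simpl INR in h.
  replace (2 * _) with (2 * (cos x ^ 2 * ln (cos x) - sin x ^ 2 * ln (sin x))
                        / (sin x ^ 2 * cos x ^ 2)) by (field; lra).
  apply Rdiv_le_0_compat; [lra|pos].
Qed.

(** The total s is fixed and the split (x, s - x) moves from (0, s) to (a, b); the sum of the two
    values does not increase. This needs [sine_slope x <= sine_slope (s - x)]. When s - x lies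
    beyond pi/4 it is reflected to pi/2 - (s - x), which is still at least x because s <= pi/2. *)
Lemma rogersL_sin2_superadditive (a b : R) :
  0 < a -> a <= b -> a + b <= PI / 2 ->
  rogersL (sin a ^ 2) + rogersL (sin b ^ 2) <= rogersL (sin (a + b) ^ 2).
Proof.
intros ha hab hs. pose proof PI_RGT_0 as hpi. set (s := a + b) in *.
set (g := fun x => - (rogersL (sin x ^ 2) + rogersL (sin (s - x) ^ 2))).
assert (h : g 0 <= g a).
{ apply (nondecreasing_of_derive_nonneg g
    (fun x => - (sine_slope x + - 1 * sine_slope (s - x)))); [lra| | |].
  - intros x hx. unfold g. apply (is_derive_opp (V := R_NormedModule)).
    apply (is_derive_plus (V := R_NormedModule)).
    + apply is_derive_rogersL_sin2. unfold s in *; lra.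
    + apply (is_derive_comp (fun x => rogersL (sin x ^ 2)) (fun x => s - x)).
      * apply is_derive_rogersL_sin2. unfold s in *. lra.
      * auto_derive; [easy|ring].
  - intros x _. apply (continuous_opp (V := R_NormedModule)).
    apply continuous_Rplus; apply continuous_rogersL_comp; auto_derive; easy.
  - intros x hx. assert (hle : sine_slope x <= sine_slope (s - x)); [|lra].
    destruct (Rle_lt_dec (s - x) (PI / 4)) as [h|h].
    + apply sine_slope_le; unfold s in *; lra.
    + rewrite <- (sine_slope_refl (s - x)). apply sine_slope_le; unfold s in *; lra. }
unfold g in h. rewrite sin_0, Rminus_0_r in h.
replace (s - a) with b in h by (unfold s; ring).
replace (0 ^ 2) with 0 in h by ring. rewrite rogersL_0 in h. lra.
Qed.

Lemma sin_cos_atan (v : R) :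
  sin (atan v) = v * cos (atan v) /\ cos (atan v) ^ 2 = / (1 + v ^ 2)
  /\ 0 < cos (atan v).
Proof.
pose proof (atan_bound v) as hb.
assert (hc : 0 < cos (atan v)) by (apply cos_gt_0; lra).
assert (e : sin (atan v) = v * cos (atan v)).
{ rewrite <- (tan_atan v) at 2. unfold tan. field. lra. }
split; [easy|]. split; [|easy].
pose proof (sin2_cos2 (atan v)) as e'. unfold Rsqr in e'. rewrite e in e'.
assert (0 < 1 + v ^ 2) by nra.
field_simplify_eq; [|lra]. lra.
Qed.

(* With tan a = y sqrt x and tan b = y / sqrt x, the three arguments are sin^2 (a + b),
   sin^2 b and sin^2 a; the product of the tangents is y^2 <= 1. *)
Lemma gap_angle_form_nonneg (x y : R) :
  0 < x <= 1 -> 0 < y <= 1 -> 0 <= gap_angle_form x (y ^ 2).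
Proof.
intros hx hy.
assert (hq : 0 < sqrt x) by (apply sqrt_lt_R0; lra).
assert (eq : sqrt x ^ 2 = x) by (apply pow2_sqrt; lra).
set (q := sqrt x) in *.
assert (hyq : 0 < y * q) by pos.
set (a := atan (y * q)). set (b := atan (y / q)).
assert (ha : 0 < a) by (rewrite <- atan_0; apply atan_increasing; easy).
assert (hab : a <= b).
{ unfold a, b. destruct (Req_dec (y * q) (y / q)) as [-> | hne]; [lra|].
  apply Rlt_le, atan_increasing.
  assert (y * q <= y / q); [|lra].
  apply (Rle_div_r (y * q)); [easy|]. replace (y * q * q) with (y * x) by (rewrite <- eq; ring). rewrite <- (Rmult_1_r y) at 2. apply Rmult_le_compat_l; lra. }
assert (hs : a + b <= PI / 2).
{ pose proof (atan_inv (y * q) hyq) as e.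
  assert (b <= atan (/ (y * q))); [|unfold a in *; lra].
  unfold b. destruct (Req_dec (y / q) (/ (y * q))) as [-> | hne]; [lra|].
  apply Rlt_le, atan_increasing.
  assert (y / q <= / (y * q)); [|lra].
  rewrite Rinv_mult. unfold Rdiv. apply Rmult_le_compat_r.
  - now apply Rlt_le, Rinv_0_lt_compat.
  - apply Rle_trans with 1; [lra|]. rewrite <- Rinv_1. apply Rinv_le_contravar; lra. }
pose proof (rogersL_sin2_superadditive a b ha hab hs) as h.
rewrite sin_plus in h.
destruct (sin_cos_atan (y * q)) as [s1 [c1 _]]. fold a in s1, c1.
destruct (sin_cos_atan (y / q)) as [s2 [c2 _]]. fold b in s2, c2.
rewrite s1, s2 in h.
replace ((y * q * cos a) ^ 2) with ((y * q) ^ 2 * cos a ^ 2) in h by ring.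
replace ((y / q * cos b) ^ 2) with ((y / q) ^ 2 * cos b ^ 2) in h by ring.
replace ((y * q * cos a * cos b + cos a * (y / q * cos b)) ^ 2)
  with ((y * q + y / q) ^ 2 * cos a ^ 2 * cos b ^ 2) in h by ring.
rewrite c1, c2 in h.
assert (hy2 : 0 < y ^ 2) by pos.
unfold gap_angle_form. rewrite <- eq.
replace ((1 + q ^ 2) ^ 2 * y ^ 2 / _)
  with ((y * q + y / q) ^ 2 * / (1 + (y * q) ^ 2) * / (1 + (y / q) ^ 2)).
2: { field. repeat split; try lra; apply Rgt_not_eq; pos. }
replace (y ^ 2 / _) with ((y / q) ^ 2 * / (1 + (y / q) ^ 2)).
2: { field. repeat split; try lra; apply Rgt_not_eq; pos. }
replace (q ^ 2 * y ^ 2 / _) with ((y * q) ^ 2 * / (1 + (y * q) ^ 2)).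
2: { field. repeat split; try lra; apply Rgt_not_eq; pos. }
lra.
Qed.

(** * The diagonal bound *)

Lemma neg_ln_one_sub_ge (w : R) :
  0 <= w < 1 -> w + w ^ 2 / 2 + w ^ 3 / 3 <= - ln (1 - w).
Proof.
intros hw.
assert (h : - ln (1 - 0) - (0 + 0 ^ 2 / 2 + 0 ^ 3 / 3)
            <= - ln (1 - w) - (w + w ^ 2 / 2 + w ^ 3 / 3)).
{ apply (nondecreasing_of_derive_nonneg
    (fun w => - ln (1 - w) - (w + w ^ 2 / 2 + w ^ 3 / 3))
    (fun w => w ^ 3 / (1 - w))); [easy| | |].
  - intros x hx. auto_derive; [lra|field; lra].
  - intros x hx.
    apply (ex_derive_continuous (fun w => - ln (1 - w) - (w + w ^ 2 / 2 + w ^ 3 / 3))).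
    auto_derive. lra.
  - intros x hx. apply Rdiv_le_0_compat; [nonneg|lra]. }
rewrite Rminus_0_r, ln_1 in h. lra.
Qed.

(** The tail of the series, the sum of w^n/n from n = 3 on, is at most w^3/3 times a geometric
    series. *)
Lemma neg_ln_one_sub_le (w : R) :
  0 <= w < 1 -> - ln (1 - w) <= w + w ^ 2 / 2 + w ^ 3 / (3 * (1 - w)).
Proof.
intros hw.
assert (h : (0 + 0 ^ 2 / 2 + 0 ^ 3 / (3 * (1 - 0))) + ln (1 - 0)
            <= (w + w ^ 2 / 2 + w ^ 3 / (3 * (1 - w))) + ln (1 - w)).
{ apply (nondecreasing_of_derive_nonneg
    (fun w => (w + w ^ 2 / 2 + w ^ 3 / (3 * (1 - w))) + ln (1 - w))
    (fun w => w ^ 3 / (3 * (1 - w) ^ 2))); [easy| | |].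
  - intros x hx. auto_derive; [lra|field; lra].
  - intros x hx.
    apply (ex_derive_continuous
      (fun w => (w + w ^ 2 / 2 + w ^ 3 / (3 * (1 - w))) + ln (1 - w))).
    auto_derive. lra.
  - intros x hx. apply Rdiv_le_0_compat; [nonneg|].
    apply Rmult_lt_0_compat; [lra|apply pow_lt; lra]. }
rewrite Rminus_0_r, ln_1 in h. lra.
Qed.

Lemma ln_one_add_ge (z : R) : 0 <= z -> z - z ^ 2 / 2 <= ln (1 + z).
Proof.
intros hz.
assert (h : ln (1 + 0) - (0 - 0 ^ 2 / 2) <= ln (1 + z) - (z - z ^ 2 / 2)).
{ apply (nondecreasing_of_derive_nonneg (fun z => ln (1 + z) - (z - z ^ 2 / 2))
    (fun z => z ^ 2 / (1 + z))); [easy| | |].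
  - intros x hx. auto_derive; [lra|field; lra].
  - intros x hx. apply (ex_derive_continuous (fun z => ln (1 + z) - (z - z ^ 2 / 2))).
    auto_derive. lra.
  - intros x hx. apply Rdiv_le_0_compat; [nonneg|lra]. }
rewrite Rplus_0_r, ln_1 in h. lra.
Qed.

Definition diag_slope (t : R) : R :=
  ln (1 - t) * ((t - 2 * t ^ 2) / (1 - t + t ^ 2))
  - ln (1 - t + t ^ 2) * (t / (1 - t)) + ln (1 + t ^ 3) - 2 * t ^ 3
  + 3 * t ^ 6 / (1 + t ^ 3) * ln t.

(** Every logarithm is replaced by a rational bound. All orders up to t^3 cancel, so the bounds on
    ln(1 - t) and ln(1 - t + t^2) must be of third order to keep the leading term 2 t^4. *)
Lemma diag_slope_pos (t : R) : 0 < t < 1 -> 0 < diag_slope t.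
Proof.
intros ht.
assert (hQ : 0 < 1 - t + t ^ 2) by nra.
assert (hP : 0 < 1 + t ^ 3) by pos.
pose proof (ln_one_add_ge (t ^ 3) ltac:(nonneg)) as h1.
pose proof (neg_ln_one_sub_ge (t - t ^ 2) ltac:(nra)) as h2.
replace (1 - (t - t ^ 2)) with (1 - t + t ^ 2) in h2 by ring.
apply (Rmult_le_compat_r (t / (1 - t))) in h2; [|apply Rdiv_le_0_compat; lra].
pose proof (ln_ge_1_sub_inv t (proj1 ht)) as h3.
assert (h3' : 3 * t ^ 6 / (1 + t ^ 3) * (1 - / t) <= 3 * t ^ 6 / (1 + t ^ 3) * ln t).
{ apply Rmult_le_compat_l; [apply Rdiv_le_0_compat; [nonneg|easy]|easy]. }
unfold diag_slope.
(* The coefficient t - 2t^2 of ln(1 - t) changes sign at 1/2, so -ln(1 - t) has to be bounded above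
   on one side and below on the other. The polynomials in both cases are the sum of all bounds over
   a common denominator. *)
destruct (Rle_lt_dec t (1 / 2)) as [hh|hh].
- pose proof (neg_ln_one_sub_le t ltac:(lra)) as h4.
  apply (Rmult_le_compat_r ((t - 2 * t ^ 2) / (1 - t + t ^ 2))) in h4;
    [|apply Rdiv_le_0_compat; nra].
  assert (0 < t ^ 4 * (12 - 22 * t + 28 * t ^ 2 - 15 * t ^ 3 - 3 * t ^ 4 + 3 * t ^ 5 + t ^ 6)
              / (6 * (1 - t) * (1 + t ^ 3))).
  { apply Rdiv_lt_0_compat; [|pos]. apply Rmult_lt_0_compat; [pos|].
    assert (0 < t ^ 2) by pos. assert (0 < t ^ 5) by pos. assert (0 < t ^ 6) by pos.
    assert (t ^ 3 <= t ^ 2 / 2) by nra. assert (t ^ 4 <= t ^ 2 / 4) by nra. nra. }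
  replace (_ / (6 * (1 - t) * (1 + t ^ 3))) with
    (- (t + t ^ 2 / 2 + t ^ 3 / (3 * (1 - t))) * ((t - 2 * t ^ 2) / (1 - t + t ^ 2))
     + (t - t ^ 2 + (t - t ^ 2) ^ 2 / 2 + (t - t ^ 2) ^ 3 / 3) * (t / (1 - t))
     + (t ^ 3 - (t ^ 3) ^ 2 / 2) - 2 * t ^ 3 + 3 * t ^ 6 / (1 + t ^ 3) * (1 - / t)) in H.
  + lra.
  + field. repeat split; lra.
- pose proof (neg_ln_one_sub_ge t ltac:(lra)) as h4.
  apply (Rmult_le_compat_r ((2 * t ^ 2 - t) / (1 - t + t ^ 2))) in h4;
    [|apply Rdiv_le_0_compat; nra].
  replace (ln (1 - t) * ((t - 2 * t ^ 2) / (1 - t + t ^ 2)))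
    with (- ln (1 - t) * ((2 * t ^ 2 - t) / (1 - t + t ^ 2))) by (field; lra).
  assert (0 < t ^ 4 * (12 - 8 * t + 18 * t ^ 2 - t ^ 3 - 4 * t ^ 4 - t ^ 5)
              / (6 * (1 + t ^ 3))).
  { apply Rdiv_lt_0_compat; [|pos]. apply Rmult_lt_0_compat; [pos|].
    assert (0 < t ^ 2) by pos.
    assert (t ^ 3 <= t ^ 2) by nra. assert (t ^ 4 <= t ^ 2) by nra.
    assert (t ^ 5 <= t ^ 2) by nra. lra. }
  replace (_ / (6 * (1 + t ^ 3))) with
    ((t + t ^ 2 / 2 + t ^ 3 / 3) * ((2 * t ^ 2 - t) / (1 - t + t ^ 2))
     + (t - t ^ 2 + (t - t ^ 2) ^ 2 / 2 + (t - t ^ 2) ^ 3 / 3) * (t / (1 - t))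
     + (t ^ 3 - (t ^ 3) ^ 2 / 2) - 2 * t ^ 3 + 3 * t ^ 6 / (1 + t ^ 3) * (1 - / t)) in H.
  + lra.
  + field. repeat split; lra.
Qed.

(** By the closed form of [phi], this is the difference of the two sides of the diagonal bound
    divided by 24. *)
Definition diag_excess (t : R) : R :=
  2 * summand (t ^ 2) (t ^ 3) - t ^ 3 * (1 - ln t).

Lemma is_derive_diag_excess (t : R) :
  0 < t < 1 -> is_derive diag_excess t (diag_slope t / t).
Proof.
intros ht.
assert (hQ : 0 < 1 - t + t ^ 2) by nra.
assert (hP : 0 < 1 + t ^ 3) by pos.
jet (fun x : R => x) t (/ t) h1.
jet (fun x : R => 1 - x) t (- / (1 - t)) h2.
jet (fun x : R => 1 + x) t (/ (1 + t)) h3.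
jet (fun x : R => 1 - x + x ^ 2) t ((2 * t - 1) / (1 - t + t ^ 2)) h4.
unfold diag_excess.
(* Rewrites the logarithm in terms of the factors that carry jets. *)
assert (eP : ln (1 + t ^ 3) = ln (1 + t) + ln (1 - t + t ^ 2)).
{ rewrite <- ln_mult by lra. f_equal. ring. }
eapply eq_rect with (P := is_derive _ t).
- apply (is_derive_minus (V := R_NormedModule)); [apply is_derive_scal|].
  + eapply (is_derive_summand (fun x => x ^ 2) (fun x => x ^ 3)).
    * log_jets.
    * apply log_jet_ext with (fun x => (1 - x) * (1 + x)); [intros; ring|log_jets].
    * apply log_jet_ext with (fun x => x ^ 2 * x); [intros; ring|log_jets].
    * apply log_jet_ext with (fun x => (1 + x) * (1 - x + x ^ 2)); [intros; ring|log_jets].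
    * apply log_jet_ext with (fun x => x ^ 2 * (1 + x)); [intros; ring|log_jets].
  + instantiate (1 := 2 * t ^ 2 - 3 * t ^ 2 * ln t).
    auto_derive; [easy|field; lra].
- unfold diag_slope. rewrite eP.
  unfold wedge, minus, plus, opp, scal; simpl. unfold mult; simpl.
  field. repeat split; nra.
Qed.

Lemma summand_nonneg (s u : R) : 0 < s <= 1 -> 0 < u -> 0 <= summand s u.
Proof.
intros hs hu. replace 0 with (summand 0 u).
- apply Rlt_le, summand_lt_s; lra.
- unfold summand. rewrite Rplus_0_l, rogersL_0. ring.
Qed.

Lemma diag_excess_lt (s t : R) : 0 < s -> s < t -> t <= 1 -> diag_excess s < diag_excess t.
Proof.
intros hs hst ht.
apply (increasing_of_derive_pos diag_excess (fun t => diag_slope t / t)); [easy| | |].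
- intros x hx. apply is_derive_diag_excess. lra.
- intros x hx. unfold diag_excess. apply continuous_Rminus.
  + apply continuous_Rscal, continuous_summand; [ex_der|ex_der|nonneg].
  + apply (ex_derive_continuous (fun t => t ^ 3 * (1 - ln t))). auto_derive. lra.
- intros x hx. apply Rdiv_lt_0_compat; [apply diag_slope_pos|]; lra.
Qed.

(** The limit at 0 is replaced by [diag_excess e >= - e ^ 2], from [summand] >= 0 and e^3 (1 - ln e)
    <= e^2. If the value at t/2 were negative, the chosen e would satisfy -e^2 > -e >=
    [diag_excess (t / 2)] with e < t/2, against monotonicity. *)
Lemma diag_excess_pos (t : R) : 0 < t <= 1 -> 0 < diag_excess t.
Proof.
intros ht.
pose proof (diag_excess_lt (t / 2) t ltac:(lra) ltac:(lra) ltac:(lra)) as h.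
destruct (Rle_lt_dec 0 (diag_excess (t / 2))) as [h0|h0]; [lra|exfalso].
set (e := Rmin (t / 4) (- diag_excess (t / 2))).
assert (he : 0 < e) by (apply Rmin_glb_lt; lra).
assert (he1 : e <= t / 4) by apply Rmin_l.
assert (he2 : e <= - diag_excess (t / 2)) by apply Rmin_r.
pose proof (diag_excess_lt e (t / 2) he ltac:(lra) ltac:(lra)) as h1.
assert (h2 : - e ^ 2 <= diag_excess e).
{ unfold diag_excess.
  pose proof (summand_nonneg (e ^ 2) (e ^ 3) ltac:(nra) ltac:(pos)).
  pose proof (ln_ge_1_sub_inv e he) as h3.
  assert (e ^ 3 * (1 - ln e) <= e ^ 3 * / e).
  { apply Rmult_le_compat_l; [nonneg|lra]. }
  replace (e ^ 3 * / e) with (e ^ 2) in H0 by (field; lra). lra. }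
nra.
Qed.

Lemma phi_diagonal_gt (t : R) :
  0 < t <= 1 -> - 24 * t ^ 3 * ln t + 24 * t ^ 3 < phi t t t.
Proof.
intros ht. rewrite phi_closed_form by easy.
replace (t * t * t) with (t ^ 3) by ring.
pose proof (diag_excess_pos t ht) as h. unfold diag_excess in h. lra.
Qed.

Lemma cbrt_pow3 (w : R) : 0 < w -> cbrt w ^ 3 = w.
Proof.
intros hw. unfold cbrt. rewrite <- Rpower_pow by apply exp_pos.
rewrite Rpower_mult. replace (1 / 3 * INR 3) with 1 by (simpl; field).
now apply Rpower_1.
Qed.

Theorem theorem1p1 :
  (* (1) *)
  ((forall x y z : R, 0 < x <= 1 -> 0 < y <= 1 -> 0 < z <= 1 ->
      strictly_increasing_Ioc01 (fun s => phi s y z) /\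
      strictly_increasing_Ioc01 (fun s => phi x s z) /\
      strictly_increasing_Ioc01 (fun s => phi x y s)) /\
   (forall x y : R, 0 < x <= 1 -> 0 < y <= 1 ->
      strictly_increasing_Ioc01 (fun s => eta s y) /\
      strictly_increasing_Ioc01 (fun s => eta x s))) /\
  (* (2) *)
  (forall x y : R, 0 < x <= 1 -> 0 < y <= 1 -> phi x y y <= eta x y) /\
  (* (3) *)
  (forall x y z : R, 0 < x <= 1 -> 0 < y <= 1 -> 0 < z <= 1 ->
      let t := cbrt (x * y * z) in
      phi x y z >= phi t t t /\
      phi t t t > - 24 * t ^ 3 * ln t + 24 * t ^ 3).
Proof.
split; [split|split].
- intros x y z hx hy hz. split; [|split]; intros s t hs ht hst.
  + apply phi_lt_1; lra.
  + rewrite (phi_swap12 x s z), (phi_swap12 x t z). apply phi_lt_1; lra.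
  + rewrite (phi_swap13 x y s), (phi_swap13 x y t). apply phi_lt_1; lra.
- intros x y hx hy. split; intros s t hs ht hst.
  + apply eta_lt_1; lra.
  + apply eta_lt_2; lra.
- intros x y hx hy.
  pose proof (gap_closed_form x y hx hy).
  pose proof (gap_angle_form_nonneg x y hx hy). lra.
- intros x y z hx hy hz t.
  assert (hw : 0 < x * y * z) by pos.
  assert (ht : 0 < t) by apply exp_pos.
  assert (ht3 : t ^ 3 = x * y * z) by now apply cbrt_pow3.
  assert (hxy : x * y <= x) by nra.
  assert (hxyz : x * y * z <= x * y) by nra.
  assert (hyz : x * y * z <= y) by nra.
  assert (hz' : x * y * z <= z) by nra.
  assert (ht1 : t <= 1).
  { destruct (Rle_lt_dec t 1) as [h|h]; [easy|].
    pose proof (Rlt_pow_R1 t 3 h ltac:(lia)). lra. }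
  split; [apply Rle_ge|now apply phi_diagonal_gt].
  (* Tangents exist only at t < 1; t = 1 forces x = y = z = 1, where the two sides coincide. *)
  destruct ht1 as [ht1 | ht1]; [now apply phi_ge_diagonal|].
  rewrite ht1, pow1 in ht3.
  replace x with 1 by lra. replace y with 1 by lra. replace z with 1 by lra.
  rewrite ht1. lra.
Qed.
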